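(* Let $\Omega\subset\mathbb{R}^N$ be a smooth bounded domain and $1<\alpha<3$. Assume that there exist a subsolution $u_0$ and a supersolution $u^0$ of the problem $$-\Delta u=\frac{1}{u^\alpha}\ \text{ in }\Omega,\qquad u=0\ \text{ on }\partial\Omega,$$ and constants $c_1,c_2$ such that $$0<c_1 d(x)^{\frac{2}{1+\alpha}}\le u_0\le u^0\le c_2 d(x)^{\frac{2}{1+\alpha}}\quad\text{in }\Omega.$$ Then there exist a minimal solution $\underline{u}$ and a maximal solution $\overline{u}$ of the problem (in the interval $[u_0,u^0]$), with $$u_0\le\underline{u}\le\overline{u}\le u^0 .$$
   Context: $d(x)=\mathrm{dist}(x,\partial\Omega)$. Functions $u_0,u^0\in H^1_0(\Omega)\cap L^\infty(\Omega)$ are called respectively a subsolution and a supersolution of the problem if $$\int_\Omega\nabla u_0\cdot\nabla v\,dx-\int_\Omega u_0^{-\alpha}v\,dx\le 0\le\int_\Omega\nabla u^0\cdot\nabla v\,dx-\int_\Omega (u^0)^{-\alpha}v\,dx\quad\text{for all }v\in H^1_0(\Omega),\ v\ge 0.$$ A (weak) solution $u$ with $u_0\le u\le u^0$ is a function $u\in H^1_0(\Omega)$ with $\int_\Omega\nabla u\cdot\nabla v\,dx=\int_\Omega u^{-\alpha}v\,dx$ for all $v\in H^1_0(\Omega)$. Minimal (resp. maximal) means: every solution $u$ with $u_0\le u\le u^0$ a.e. in $\Omega$ satisfies $\underline{u}\le u$ (resp. $u\le\overline{u}$). All inequalities between functions are a.e. in $\Omega$. *)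

(* Defs.v *)
From HB Require Import structures.
From mathcomp Require Import all_boot all_order all_algebra.
From mathcomp Require Import all_classical all_reals all_analysis.

Set Implicit Arguments.
Unset Strict Implicit.
Unset Printing Implicit Defensive.

Import Order.TTheory GRing.Theory Num.Theory.
Import numFieldNormedType.Exports.

Local Open Scope classical_set_scope.
Local Open Scope ring_scope.

(* The ambient space R^N, N >= 1, is 'rV[R]_n.+1 with N = n.+1. Its library
   norm is the sup norm: it is used only for topological notions, which do not
   depend on the norm; distances are Euclidean. *)

Section lebesgue_measure_Rn.
Context {R : realType} {n : nat}.
Local Notation V := 'rV[R]_n.+1.

Definition box (ab : V * V) : set V :=
  [set x | forall i, ab.1 0 i < x 0 i <= ab.2 0 i].

(* The truncation at 0 makes the volume of an empty box 0. *)
Definition box_vol (ab : V * V) : R :=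
  \prod_(i < n.+1) Num.max 0 (ab.2 0 i - ab.1 0 i).

Definition lebesgue_outer (A : set V) : \bar R :=
  ereal_inf [set (\sum_(k <oo) (box_vol (B k))%:E)%E |
             B in [set B : nat -> V * V | A `<=` \bigcup_k box (B k)]].

Local Open Scope ereal_scope.

Lemma box_vol_ge0 ab : 0 <= (box_vol ab)%:E.
Proof. by rewrite lee_fin; apply: prodr_ge0 => i _; rewrite le_max lexx. Qed.

Lemma lebesgue_outer_ge0 A : 0 <= lebesgue_outer A.
Proof.
by apply: le_ereal_inf_tmp => _ [B _ <-]; apply: nneseries_ge0 => k _ _;
  exact: box_vol_ge0.
Qed.

Lemma lebesgue_outer0 : lebesgue_outer set0 = 0.
Proof.
apply/eqP; rewrite eq_le lebesgue_outer_ge0 andbT.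
apply: ereal_inf_lbound; exists (fun=> (0%R, 0%R)); first by move=> x [].
rewrite eseries0// => k _ _; congr (_%:E).
by rewrite /box_vol big_ord_recl/= subrr maxxx mul0r.
Qed.

Lemma le_lebesgue_outer : {homo lebesgue_outer : A B / A `<=` B >-> A <= B}.
Proof.
move=> A B AB; apply/ereal_inf_le_tmp => _ [C BC <-].
by exists C => //; exact: subset_trans AB BC.
Qed.

Lemma lebesgue_outer_sigma_subadditive : sigma_subadditive lebesgue_outer.
Proof.
move=> A; have [[i ioo]|] := pselect (exists i, lebesgue_outer (A i) = +oo).
  rewrite (eseries_pinfty _ _ ioo) ?leey// => k _.
  by rewrite -ltNye (lt_le_trans _ (lebesgue_outer_ge0 _)).
rewrite -forallNE => Aoo.
suff add2e (e : {posnum R}) : lebesgue_outer (\bigcup_k A k) <=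
    \sum_(i <oo) lebesgue_outer (A i) + e%:num%:E.
  by apply/lee_addgt0Pr => _/posnumP[].
rewrite (le_trans _ (epsilon_trick _ _ _))//; last first.
  by move=> k; exact: lebesgue_outer_ge0.
pose P k (B : nat -> V * V) := A k `<=` \bigcup_j box (B j) /\
  \sum_(j <oo) (box_vol (B j))%:E <=
    lebesgue_outer (A k) + (e%:num / (2 ^ k.+1)%:R)%:E.
have [G PG] : {G : nat -> nat -> V * V & forall k, P k (G k)}.
  apply: (@choice _ _ P) => k; rewrite /P /lebesgue_outer.
  set S := (X in ereal_inf X); move infS : (ereal_inf S) => iS.
  case: iS infS => [r Sr|Soo|Soo].
  - have en1 : (0 < e%:num / (2 ^ k.+1)%:R)%R by [].
    have /(lb_ereal_inf_adherent en1) : ereal_inf S \is a fin_num by rewrite Sr.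
    move=> [x [B AB muBx] xS].
    by exists B; split => //; rewrite muBx -Sr; exact/ltW.
  - by have := Aoo k; rewrite /lebesgue_outer Soo.
  - by have := lebesgue_outer_ge0 (A k); rewrite /lebesgue_outer Soo.
pose w (ij : nat * nat) := (box_vol (G ij.1 ij.2))%:E.
have w_ge0 ij : 0 <= w ij by exact: box_vol_ge0.
apply: (@le_trans _ _ (\esum_(i in setT) w i)).
  apply: ereal_inf_lbound => /=.
  have /card_esym/ppcard_eqP[f] := card_nat2.
  exists (fun k => G (f k).1 (f k).2).
    move=> t [i _ /(PG i).1[j _ Bijt]]; exists (f^-1%FUN (i, j)) => //=.
    by rewrite invK ?inE.
  rewrite -(esum_pred_image w f xpredT) ?[fun=> _]set_true//.
  by rewrite image_eq.
rewrite (_ : esum _ _ = \sum_(i <oo) \sum_(j <oo) w (i, j)); last first.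
  pose J : nat -> set (nat * nat) := fun i => [set (i, j) | j in setT].
  rewrite (_ : setT = \bigcup_k J k); last first.
    by rewrite predeqE => -[a b]; split => // _; exists a => //; exists b.
  rewrite esum_bigcupT //=; last first.
    apply/trivIsetP => i j _ _ ij.
    rewrite predeqE => -[k m] /=; split => //= -[] [_] _ [<-{k} _].
    by move=> [m' _] [] /esym/eqP; rewrite (negbTE ij).
  rewrite -(image_id [set: nat]) -fun_true esum_pred_image//; last first.
    by move=> k _; exact: esum_ge0.
  apply: eq_eseriesr => /= j _.
  rewrite -(esum_pred_image w (pair j) predT)//=; last first.
    by move=> ? ? _ _; exact: (@can_inj _ _ _ snd).
  by congr esum; rewrite predeqE => -[a b]; split; move=> [i _ <-]; exists i.
apply: lee_lim.
- by apply: is_cvg_nneseries => k *; exact: nneseries_ge0.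
- by apply: is_cvg_nneseries => k *; apply: adde_ge0 => //;
    exact: lebesgue_outer_ge0.
- by near=> k; apply: lee_sum => i _; exact: (PG i).2.
Unshelve. all: by end_near. Qed.

HB.instance Definition _ := isOuterMeasure.Build R V lebesgue_outer
  lebesgue_outer0 lebesgue_outer_ge0 le_lebesgue_outer
  lebesgue_outer_sigma_subadditive.

(* 'rV[R]_n.+1 with the Lebesgue (Caratheodory) measurable sets. *)
Definition Rn := caratheodory_type lebesgue_outer.

HB.instance Definition _ := Measurable.on Rn.

Definition lebesgue (A : set Rn) : \bar R := lebesgue_outer A.

HB.instance Definition _ := isMeasure.Build _ Rn R lebesgue
  (@caratheodory_measure0 _ _ lebesgue_outer)
  (@caratheodory_measure_ge0 _ _ lebesgue_outer)
  (@caratheodory_measure_sigma_additive _ _ lebesgue_outer).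

End lebesgue_measure_Rn.

Arguments Rn : clear implicits.
Arguments lebesgue : clear implicits.

Section smooth.
Context {R : realType} {m : nat}.

Definition partial (i : 'I_m) (f : 'rV[R]_m -> R) : 'rV[R]_m -> R :=
  fun x => 'D_(delta_mx 0 i) f x.

(* C^oo on the whole space: all iterated partial derivatives exist and are
   continuous. *)
Definition smooth (f : 'rV[R]_m -> R) : Prop :=
  forall s : seq 'I_m, let g := foldr partial f s in
    continuous g /\ forall i x, derivable g x (delta_mx 0 i).

End smooth.

Section domain.
Context {R : realType} {n : nat}.
Local Notation V := 'rV[R]_n.+1.

Definition enorm (x : V) : R := Num.sqrt (\sum_(i < n.+1) x 0 i ^+ 2).

Definition boundary (Omega : set V) : set V := closure Omega `\` interior Omega.

Definition bdist (Omega : set V) (x : V) : R :=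
  inf [set enorm (x - y) | y in boundary Omega].

(* Near each boundary point Omega is, up to relabelling and reorienting the
   coordinate axes, the region strictly above the graph of a C^oo function of
   the remaining coordinates. *)
Definition smooth_boundary (Omega : set V) : Prop :=
  forall x0, boundary Omega x0 ->
    exists (i : 'I_n.+1) (b : bool) (gamma : 'rV[R]_n -> R),
      smooth gamma /\
      \forall x \near x0, Omega x <-> gamma (col' i x) < (-1) ^+ b * x 0 i.

Definition smooth_bounded_domain (Omega : set V) : Prop :=
  [/\ open Omega, connected Omega, Omega !=set0, bounded_set Omega
    & smooth_boundary Omega].

End domain.

Section sobolev.
Context {R : realType} {n : nat}.
Variable Omega : set 'rV[R]_n.+1.
Local Notation V := 'rV[R]_n.+1.
Local Notation mu := (lebesgue R n).

(* C_c^oo(Omega), its elements being extended by 0 to the whole space. *)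
Definition test_function (phi : V -> R) : Prop :=
  let S := closure [set x | phi x != 0] in
  [/\ smooth phi, compact S & S `<=` Omega].

Definition L2 (f : V -> R) : Prop :=
  measurable_fun (Omega : set (Rn R n)) (f : Rn R n -> R) /\
  mu.-integrable Omega (fun x => (f x ^+ 2)%:E).

Definition Linfty (f : V -> R) : Prop :=
  measurable_fun (Omega : set (Rn R n)) (f : Rn R n -> R) /\
  exists M : R, {ae mu, forall x, Omega x -> `|f x| <= M}.

Definition weak_gradient (f : V -> R) (g : V -> V) : Prop :=
  forall phi, test_function phi -> forall i,
    (\int[mu]_(x in Omega) (f x * partial i phi x)%:E =
     - \int[mu]_(x in Omega) (g x 0 i * phi x)%:E)%E.

(* || f - phi ||^2 in H^1(Omega), where g is the weak gradient of f and phi is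
   smooth. *)
Definition H1_sqdist (f : V -> R) (g : V -> V) (phi : V -> R) : \bar R :=
  (\int[mu]_(x in Omega)
    ((f x - phi x) ^+ 2
     + \sum_(i < n.+1) (g x 0 i - partial i phi x) ^+ 2)%:E)%E.

(* H^1_0(Omega), the closure of C_c^oo(Omega) in H^1(Omega). An element is a
   function bundled with its weak gradient, which the function determines up to
   a null set; only values in Omega matter. *)
Record H10 := MkH10 {
  H10_fun :> V -> R ;
  grad : V -> V ;
  H10_L2 : L2 H10_fun ;
  H10_grad_L2 : forall i, L2 (fun x => grad x 0 i) ;
  H10_weak_gradient : weak_gradient H10_fun grad ;
  H10_closure : forall e : R, 0 < e ->
    exists2 phi, test_function phi & (H1_sqdist H10_fun grad phi < e%:E)%E }.

Definition ae_le (f g : V -> R) : Prop :=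
  {ae mu, forall x, Omega x -> f x <= g x}.

Definition dirichlet (u v : H10) : \bar R :=
  (\int[mu]_(x in Omega) (\sum_(i < n.+1) grad u x 0 i * grad v x 0 i)%:E)%E.

Variable alpha : R.

(* Used for u > 0 a.e. only: [powR] is not meaningful at negative reals, and
   0 `^ (- alpha) = 0 in the library. For v >= 0 this integral always makes
   sense in [0, +oo]. *)
Definition singular_term (u v : H10) : \bar R :=
  (\int[mu]_(x in Omega) (u x `^ (- alpha) * v x)%:E)%E.

Definition subsolution (u : H10) : Prop :=
  forall v : H10, ae_le (cst 0) v ->
    (dirichlet u v - singular_term u v <= 0)%E.

Definition supersolution (u : H10) : Prop :=
  forall v : H10, ae_le (cst 0) v ->
    (0 <= dirichlet u v - singular_term u v)%E.

Definition weak_solution (u : H10) : Prop :=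
  forall v : H10,
    mu.-integrable Omega (fun x => (u x `^ (- alpha) * v x)%:E) /\
    dirichlet u v = singular_term u v.

Definition solution_between (lo hi u : H10) : Prop :=
  [/\ weak_solution u, ae_le lo u & ae_le u hi].

Definition minimal_solution (lo hi u : H10) : Prop :=
  solution_between lo hi u /\
  forall w, solution_between lo hi w -> ae_le u w.

Definition maximal_solution (lo hi u : H10) : Prop :=
  solution_between lo hi u /\
  forall w, solution_between lo hi w -> ae_le w u.

End sobolev.

(* Main.v *)
Require Import Defs.
From mathcomp Require Import all_boot all_order all_algebra.
From mathcomp Require Import ring lra.
From mathcomp Require Import all_classical all_reals all_analysis.
From mathcomp Require Import measurable_realfun.

Set Implicit Arguments.
Unset Strict Implicit.
Unset Printing Implicit Defensive.

Import Order.TTheory GRing.Theory Num.Theory.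
Import numFieldNormedType.Exports.

Local Open Scope classical_set_scope.
Local Open Scope ring_scope.

(** The source term u^(-alpha) decreases in u, so the problem is the Euler
    equation of a strictly convex energy.  Two solutions between usub and usup
    coincide: subtracting their equations and testing with the difference z
    gives int |grad z|^2 <= 0 ([solution_unique]).  Hence the minimal and the
    maximal solution are one and the same function, and what remains is to
    produce a solution ([solution_exists]).

    The singular term is controlled by the supersolution inequality itself:
    tested with |v| it says that
      int usup^(-alpha) |v| <= int grad usup . grad |v| < +oo,
    so that v |-> int usup^(-alpha) |v| is bounded for the Dirichlet norm
    ([weight_intg_le], [weight_young]).  The two bounds by the same power of the
    distance give usup <= (c2 / c1) usub, so usub^(-alpha), and with it u^(-alpha)
    for every u in between, is of the order of usup^(-alpha) ([pinch_weight]).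

    For existence, u is clipped to [usub, usup] inside the source term.  The
    clipped source still decreases, so its primitive is concave, and the energy
    one half of int |grad u|^2 minus this primitive is strongly convex.  By the
    midpoint inequality a minimizing sequence is Cauchy for the Dirichlet norm,
    for which H^1_0 is complete by the Poincare inequality ([energy_minimum]).
    The minimizer w solves the clipped equation ([euler]); testing it against
    the inequalities of usub and usup with (usub - w)^+ and (w - usup)^+ yields
    usub <= w <= usup ([sub_le_critical], [critical_le_super]), and there the
    clipping does nothing.

    The facts about H^1_0 used here are proved from its definition as a closure
    of test functions.  Translation invariance of the Lebesgue measure gives
    int d_i psi = 0 for compactly supported C^1 functions
    ([Rintegral_partial0]); integration by parts, the weak gradient of a limit
    of test functions and the Poincare inequality follow.  That |u| lies in H^1_0
    with gradient sgn(u) grad u ([H10_abs]) is seen by approximating |s| with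
    the smooth functions sqrt(s^2 + e^2) - e.  Completeness comes from that of
    L^2 ([sqint_complete]). *)

(** * Square integrable functions *)

Lemma ae_in_imply d (T : measurableType d) (R : realType)
    (mu : {measure set T -> \bar R}) (D : set T) (P Q : T -> Prop) :
  (forall x, D x -> P x -> Q x) ->
  {ae mu, forall x, D x -> P x} -> {ae mu, forall x, D x -> Q x}.
Proof. by move=> PQ; apply: filterS => x Px Dx; exact: PQ (Px Dx). Qed.

Lemma ae_in_and d (T : measurableType d) (R : realType)
    (mu : {measure set T -> \bar R}) (D : set T) (P Q : T -> Prop) :
  {ae mu, forall x, D x -> P x} -> {ae mu, forall x, D x -> Q x} ->
  {ae mu, forall x, D x -> P x /\ Q x}.
Proof. by apply: filterS2 => x Px Qx Dx; split; [exact: Px|exact: Qx]. Qed.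

Lemma ae_in_all d (T : measurableType d) (R : realType)
    (mu : {measure set T -> \bar R}) (D : set T) (P : T -> Prop) :
  (forall x, D x -> P x) -> {ae mu, forall x, D x -> P x}.
Proof. by move=> DP; exact: aeW. Qed.

Section square_integrable.
Context d (T : measurableType d) (R : realType).
Variables (mu : {measure set T -> \bar R}) (D : set T).
Hypothesis mD : measurable D.
Local Notation Int f := (\int[mu]_(x in D) f x)%R.
Local Notation intg f := (mu.-integrable D (EFin \o f)).
Implicit Types f g h : T -> R.

Definition sqint f := measurable_fun D f /\ intg (fun x => f x ^+ 2).

Lemma intg_measurable f : intg f -> measurable_fun D f.
Proof. by move=> /measurable_int /measurable_EFinP. Qed.

Lemma le_intg f g : measurable_fun D f -> (forall x, D x -> `|f x| <= g x) ->
  intg g -> intg f.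
Proof.
move=> mf fg; apply: le_integrable => //; first exact/measurable_EFinP.
by move=> x Dx /=; rewrite lee_fin (le_trans (fg _ Dx))// ler_norm.
Qed.

Lemma intgD f g : intg f -> intg g -> intg (fun x => f x + g x).
Proof. by move=> fi gi; exact: (integrableD mD fi gi). Qed.

Lemma intgB f g : intg f -> intg g -> intg (fun x => f x - g x).
Proof. by move=> fi gi; exact: (integrableB mD fi gi). Qed.

Lemma intgZ c f : intg f -> intg (fun x => c * f x).
Proof. by move=> fi; exact: (integrableZl mD c fi). Qed.

Lemma intg_sum (I : Type) (s : seq I) (F : I -> T -> R) :
  (forall i, intg (F i)) -> intg (fun x => \sum_(i <- s) F i x).
Proof.
move=> iF; elim: s => [|i s IH].
  by under eq_fun do rewrite big_nil; exact: integrable0.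
by under eq_fun do rewrite big_cons; exact: intgD.
Qed.

Lemma Int_sum (I : Type) (s : seq I) (F : I -> T -> R) :
  (forall i, intg (F i)) ->
  Int (fun x => \sum_(i <- s) F i x) = \sum_(i <- s) Int (F i).
Proof.
move=> iF; elim: s => [|i s IH].
  under eq_Rintegral do rewrite big_nil.
  by rewrite big_nil Rintegral_cst// mul0r.
under eq_Rintegral do rewrite big_cons.
by rewrite big_cons RintegralD// ?IH//; exact: intg_sum.
Qed.

Lemma ae_eq_intg f g : measurable_fun D g ->
  {ae mu, forall x, D x -> f x = g x} -> intg f -> intg g.
Proof.
move=> mg fg /integrableP[mf foo]; apply/integrableP.
split; first exact/measurable_EFinP.
rewrite (ae_eq_integral (fun x => `|(EFin \o f) x|)%E) => //.
- by apply: measurableT_comp => //; exact/measurable_EFinP.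
- by apply: measurableT_comp => //; exact: mf.
- by apply: filterS fg => x /[apply] /= ->.
Qed.

Lemma ae_eq_Int f g : measurable_fun D f -> measurable_fun D g ->
  {ae mu, forall x, D x -> f x = g x} -> Int f = Int g.
Proof.
move=> mf mg fg; congr fine; apply: ae_eq_integral => //.
- exact/measurable_EFinP.
- exact/measurable_EFinP.
- by apply: filterS fg => x /[apply] ->.
Qed.

Lemma ae_le_Int f g : intg f -> intg g ->
  {ae mu, forall x, D x -> f x <= g x} -> Int f <= Int g.
Proof.
move=> fi gi fg; rewrite -subr_ge0 -RintegralB//.
have mgf : measurable_fun D (fun x => g x - f x).
  by apply: measurable_funB; exact: intg_measurable.
rewrite (@ae_eq_Int _ (fun x => `|g x - f x|))//.
- exact: Rintegral_ge0.
- exact: measurableT_comp.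
- by apply: filterS fg => x /[apply]; rewrite -subr_ge0 => /ger0_norm.
Qed.

(** Since |f g| <= f^2 + g^2. *)
Lemma intgM f g : sqint f -> sqint g -> intg (fun x => f x * g x).
Proof.
move=> [mf fi] [mg gi]; apply: le_intg (intgD fi gi).
  exact: measurable_funM.
move=> x _ /=; rewrite normrM -(real_normK (num_real (f x))).
rewrite -(real_normK (num_real (g x))).
have := sqr_ge0 (`|f x| - `|g x|); have := normr_ge0 (f x).
by have := normr_ge0 (g x); nra.
Qed.

Lemma sqintD f g : sqint f -> sqint g -> sqint (fun x => f x + g x).
Proof.
move=> [mf fi] [mg gi]; split; first exact: measurable_funD.
apply: le_intg (intgZ 2 (intgD fi gi)).
  by apply: measurable_funX; exact: measurable_funD.
move=> x _; rewrite ger0_norm ?sqr_ge0//.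
by have := sqr_ge0 (f x - g x); nra.
Qed.

Lemma sqintM_bounded h f (M : R) : measurable_fun D h ->
  (forall x, D x -> `|h x| <= M) -> sqint f -> sqint (fun x => h x * f x).
Proof.
move=> mh hM [mf fi]; split; first exact: measurable_funM.
apply: le_intg (intgZ (M ^+ 2) fi).
  by apply: measurable_funX; exact: measurable_funM.
move=> x Dx; rewrite ger0_norm ?sqr_ge0// exprMn ler_wpM2r ?sqr_ge0//.
by rewrite -(real_normK (num_real (h x))) lerXn2r ?nnegrE ?(le_trans _ (hM _ Dx)) ?hM.
Qed.

Lemma sqintZ c f : sqint f -> sqint (fun x => c * f x).
Proof. exact: (@sqintM_bounded (cst c) f `|c|). Qed.

Lemma sqintN f : sqint f -> sqint (fun x => - f x).
Proof.
by move=> /(sqintZ (-1)); congr sqint; apply/funext => x; rewrite mulN1r.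
Qed.

Lemma sqintB f g : sqint f -> sqint g -> sqint (fun x => f x - g x).
Proof. by move=> sf /sqintN; exact: sqintD. Qed.

Lemma sqint_le f g : measurable_fun D f -> (forall x, D x -> `|f x| <= `|g x|) ->
  sqint g -> sqint f.
Proof.
move=> mf fg [mg gi]; split=> //; apply: le_intg gi.
  exact: measurable_funX.
move=> x Dx; rewrite normrX -[leRHS](real_normK (num_real (g x))).
by rewrite lerXn2r ?nnegrE ?fg.
Qed.

Lemma sqint0_ae0 f : sqint f -> Int (fun x => f x ^+ 2) <= 0 ->
  {ae mu, forall x, D x -> f x = 0}.
Proof.
move=> [mf fi] I0.
have f20 : (\int[mu]_(x in D) `|(f x ^+ 2)%:E| = 0)%E.
  under eq_integral do rewrite gee0_abs ?lee_fin ?sqr_ge0//.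
  apply/eqP; rewrite eq_le integral_ge0 ?andbT; last first.
    by move=> x _; rewrite lee_fin sqr_ge0.
  by rewrite -(fineK (integrable_fin_num mD fi)) lee_fin.
have/ae_eq_integral_abs h : measurable_fun D (fun x => (f x ^+ 2)%:E).
  by apply/measurable_EFinP; exact: measurable_funX.
have [+ _] := h mu mD; move=> /(_ f20).
by apply: filterS => x /[apply] -[] /eqP; rewrite sqrf_eq0 => /eqP.
Qed.

Lemma dominated_Int (f_ : nat -> T -> R) f g :
  (forall k, measurable_fun D (f_ k)) -> measurable_fun D f ->
  {ae mu, forall x, D x -> f_ ^~ x @ \oo --> f x} ->
  intg g -> (forall k, {ae mu, forall x, D x -> `|f_ k x| <= g x}) ->
  intg f /\ (fun k => Int (f_ k)) @ \oo --> Int f.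
Proof.
move=> mf_ mf f_f ig f_g.
have [||||if_ _ cf] := @dominated_convergence _ _ _ mu D mD
    (fun k => EFin \o f_ k) (EFin \o f) (EFin \o g) _ _ _ ig.
- by move=> k; exact/measurable_EFinP.
- exact/measurable_EFinP.
- by apply: filterS f_f => x /[apply] h; apply: cvg_EFin => //; exact: nearW.
- have /ae_foralln := f_g.
  by apply: filterS => x h n Dx; rewrite lee_fin; exact: h.
- split => //; apply: fine_cvg => /=; rewrite fineK//.
  exact: integrable_fin_num.
Qed.

Hypothesis muD : (mu D < +oo)%E.

Lemma intg_bounded f (M : R) : measurable_fun D f ->
  (forall x, D x -> `|f x| <= M) -> intg f.
Proof.
move=> mf fM; apply: measurable_bounded_integrable => //.
exists M; split; first exact: num_real.
by move=> N MN x Dx /=; rewrite (le_trans (fM _ Dx))// ltW.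
Qed.

Lemma intg_cst (c : R) : intg (cst c).
Proof. by apply: (@intg_bounded _ `|c|). Qed.

Lemma sqint_bounded f (M : R) : measurable_fun D f ->
  (forall x, D x -> `|f x| <= M) -> sqint f.
Proof.
move=> mf fM; split=> //; apply: (@intg_bounded _ (M ^+ 2)).
  exact: measurable_funX.
move=> x Dx; rewrite normrX lerXn2r ?nnegrE ?(le_trans _ (fM _ Dx)) ?fM//.
Qed.

End square_integrable.

(** The increments are summable, and the tail of the geometric series bounds the
    distance to the limit. *)
Lemma geometric_cvg (R : realType) (a : nat -> R) (s : R) : 0 <= s ->
  (forall k, `|a k.+1 - a k| <= s * 2^-1 ^+ k) ->
  cvgn a /\ forall k, `|a k - limn a| <= 2 * s * 2^-1 ^+ k.
Proof.
move=> s0 aS.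
have h1 : `|2^-1 : R| < 1 by rewrite ger0_norm ?invr_ge0// invf_lt1// ltr1n.
have cva : cvgn a.
  have -> : a = (fun n => a 0%N + series (telescope a) n).
    by apply/funext => n; exact: eq_sum_telescope.
  apply: is_cvgD; first exact: is_cvg_cst.
  apply: normed_cvg; apply: series_le_cvg (is_cvg_geometric_series (a := s) h1).
  - by move=> n; rewrite /= normr_ge0.
  - by move=> n; rewrite mulr_ge0// exprn_ge0// invr_ge0.
  - exact: aS.
have aB k j : `|a k - a (k + j)%N| <= 2 * s * 2^-1 ^+ k * (1 - 2^-1 ^+ j).
  elim: j => [|j IH]; first by rewrite addn0 subrr normr0 expr0 subrr mulr0.
  rewrite addnS -(subrKA (a (k + j)%N)) (le_trans (ler_normD _ _))//.
  apply: (le_trans (lerD IH (_ : _ <= s * 2^-1 ^+ (k + j)))).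
    by rewrite distrC; exact: aS.
  rewrite exprD [in leRHS]exprS; set u := _ ^+ k; set v := _ ^+ j.
  by rewrite le_eqVlt; apply/orP; left; apply/eqP; field.
split=> // k.
have cvk : (fun n => `|a k - a n|) @ \oo --> `|a k - limn a|.
  by apply: cvg_norm; apply: cvgB => //; exact: cvg_cst.
rewrite -(cvg_lim _ cvk)//; apply: limr_le.
  by apply/cvg_ex; eexists; exact: cvk.
near=> n; have kn : (k <= n)%N by near: n; exists k.
rewrite -(subnKC kn) (le_trans (aB _ _))// ler_piMr//.
  by rewrite !mulr_ge0// exprn_ge0// invr_ge0.
Unshelve. all: by end_near. Qed.

Section L2_completeness.
Context d (T : measurableType d) (R : realType).
Variables (mu : {measure set T -> \bar R}) (D : set T).
Hypothesis mD : measurable D.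
Local Notation Int f := (\int[mu]_(x in D) f x)%R.
Local Notation intg f := (mu.-integrable D (EFin \o f)).
Implicit Types f g h : T -> R.

(** The dominating function is the sum of the series, finite almost everywhere
    because its integral is at most 2. *)
Lemma ae_dominated_summable (F : nat -> T -> R) :
  (forall k x, 0 <= F k x) -> (forall k, intg (F k)) ->
  (forall k, Int (F k) <= 2^-1 ^+ k) ->
  exists h, [/\ intg h, forall x, 0 <= h x &
    {ae mu, forall x, D x -> forall k, F k x <= h x}].
Proof.
move=> F0 Fi Fle.
pose S x := (\sum_(0 <= k <oo) (F k x)%:E)%E.
have mS : measurable_fun D S.
  apply: (@ge0_emeasurable_sum _ _ _ _ (fun k x => (F k x)%:E) xpredT).
    by move=> k x Dx _; rewrite lee_fin F0.
  by move=> k _; apply/measurable_EFinP; apply: intg_measurable (Fi k).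
have S0 x : (0 <= S x)%E.
  by apply: nneseries_ge0 => k _ _; rewrite lee_fin F0.
have iS : mu.-integrable D S.
  apply/integrableP; split=> //.
  under eq_integral do rewrite gee0_abs//.
  rewrite integral_nneseries//; last 2 first.
    by move=> k; apply/measurable_EFinP; apply: intg_measurable (Fi k).
    by move=> k x Dx; rewrite lee_fin F0.
  apply: (@le_lt_trans _ _ 2%:E); last exact: ltry.
  apply: lime_le.
    by apply: is_cvg_nneseries => k _ _; apply: integral_ge0 => x Dx; rewrite lee_fin.
  apply: nearW => n.
  rewrite (eq_bigr (fun k => (Int (F k))%:E)); last first.
    by move=> k _; rewrite fineK//; apply: integrable_fin_num => //; exact: Fi.
  rewrite sumEFin lee_fin.
  apply: (@le_trans _ _ (series (geometric 1 2^-1) n)).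
    by apply: ler_sum => k _; rewrite /= mul1r.
  have h1 : `|2^-1 : R| < 1 by rewrite ger0_norm ?invr_ge0// invf_lt1// ltr1n.
  rewrite (le_trans (geometric_le_lim n _ _ h1))//.
  by rewrite le_eqVlt; apply/orP; left; apply/eqP; field.
have aeS := integrable_ae mD iS.
have S0' x : 0 <= fine (S x) by rewrite fine_ge0.
exists (fine \o S); split => //.
- apply/integrableP; split.
    apply/measurable_EFinP; apply: (measurableT_comp _ mS); exact: fine_measurable.
  move/integrableP : iS => [_]; apply: le_lt_trans.
  apply: ae_ge0_le_integral => //.
  + by apply/measurableT_comp => //; apply/measurable_EFinP;
      apply: (measurableT_comp _ mS); exact: fine_measurable.
  + exact: measurableT_comp.
  + by apply: filterS aeS => x /[apply] Sx; rewrite /comp fineK.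
- apply: filterS aeS => x /[apply] Sx k /=.
  rewrite -lee_fin fineK//.
  apply: le_trans (nneseries_lim_ge k.+1 _); last first.
    by move=> n _ _; rewrite lee_fin.
  by rewrite big_nat_recr//= leeDr// sume_ge0// => i _; rewrite lee_fin.
Qed.

(** The functions 2^k (f_k - f)^2 have a common integrable bound h, so
    |f_k - f| <= sqrt (h / 2^k). *)
Lemma ae_cvg_fast (f_ : nat -> T -> R) f : (forall k, sqint mu D (f_ k)) -> sqint mu D f ->
  (forall k, Int (fun x => (f_ k x - f x) ^+ 2) <= 4^-1 ^+ k) ->
  {ae mu, forall x, D x -> f_ ^~ x @ \oo --> f x}.
Proof.
move=> sf_ sf fle.
pose F k x := 2 ^+ k * (f_ k x - f x) ^+ 2.
have iF k : intg (fun x => (f_ k x - f x) ^+ 2) by have [] := sqintB mD (sf_ k) sf.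
have [||k|h [hi h0 Fh]] := @ae_dominated_summable F.
- by move=> k x; rewrite /F mulr_ge0 ?sqr_ge0 ?exprn_ge0.
- by move=> k; apply: intgZ.
- rewrite /F RintegralZl// (le_trans (ler_wpM2l _ (fle k))) ?exprn_ge0//.
  by rewrite -exprMn le_eqVlt; apply/orP; left; apply/eqP; congr (_ ^+ _); field.
apply: filterS Fh => x /[apply] Fh.
have c2 : (fun k => Num.sqrt (h x) * Num.sqrt (2^-1) ^+ k) @ \oo --> (0 : R).
  rewrite -[X in _ --> X](mulr0 (Num.sqrt (h x))); apply: cvgMr.
  apply: cvg_expr; rewrite ger0_norm ?sqrtr_ge0// -[ltRHS]sqrtr1.
  by rewrite ltr_sqrt// invf_lt1// ltr1n.
apply/cvgrPdist_le => e e0.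
move/cvgrPdist_le : c2 => /(_ _ e0); apply: filterS => k; rewrite sub0r normrN.
apply: le_trans; rewrite [leRHS]ger0_norm ?mulr_ge0 ?exprn_ge0 ?sqrtr_ge0//.
rewrite distrC -sqrtr_sqr.
have -> : Num.sqrt (2^-1) ^+ k = Num.sqrt (2^-1 ^+ k) :> R.
  elim: k => [|k IH]; first by rewrite !expr0 sqrtr1.
  by rewrite !exprS IH sqrtrM// invr_ge0.
rewrite -sqrtrM// ler_sqrt ?mulr_ge0 ?exprn_ge0 ?invr_ge0//.
by rewrite exprVn ler_pdivlMr ?exprn_gt0// mulrC; exact: Fh.
Qed.

(** Riesz-Fischer, for a sequence with rapidly decreasing increments: these have an
    integrable bound h with |f_(k+1) - f_k| <= sqrt h / 2^k, which makes the
    sequence converge pointwise and the convergence dominated. *)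
Lemma sqint_complete (f_ : nat -> T -> R) : (forall k, sqint mu D (f_ k)) ->
  (forall k, Int (fun x => (f_ k.+1 x - f_ k x) ^+ 2) <= 8^-1 ^+ k) ->
  exists2 f, sqint mu D f &
    (fun k => Int (fun x => (f_ k x - f x) ^+ 2)) @ \oo --> (0 : R).
Proof.
move=> sf fle.
pose F k x := 4 ^+ k * (f_ k.+1 x - f_ k x) ^+ 2.
have iF k : intg (fun x => (f_ k.+1 x - f_ k x) ^+ 2).
  by have [] := sqintB mD (sf k.+1) (sf k).
have [||k|h [hi h0 Fh]] := @ae_dominated_summable F.
- by move=> k x; rewrite /F mulr_ge0 ?sqr_ge0 ?exprn_ge0.
- by move=> k; apply: intgZ.
- rewrite /F RintegralZl// (le_trans (ler_wpM2l _ (fle k))) ?exprn_ge0//.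
  by rewrite -exprMn le_eqVlt; apply/orP; left; apply/eqP; congr (_ ^+ _); field.
(* The sequence is set to 0 on a null set, so that it converges everywhere and
   its limit is measurable. *)
have [N [mN N0 subN]] := Fh.
pose g_ k := f_ k \_ (D `\` N).
have gh x : D x -> forall k, `|g_ k.+1 x - g_ k x| <= Num.sqrt (h x) * 2^-1 ^+ k.
  move=> Dx k; rewrite /g_ /restrict in_setD mem_set//=.
  have [/= xN|/= xN] := boolP (x \in N).
    by rewrite subrr normr0 mulr_ge0 ?sqrtr_ge0 ?exprn_ge0 ?invr_ge0.
  have /(_ k) : forall k, F k x <= h x.
    apply: contrapT => nF; move/negP: xN; apply; rewrite inE; apply: subN => /=.
    by move/(_ Dx).
  rewrite /F => FF.
  rewrite -sqrtr_sqr exprVn ler_pdivlMr ?exprn_gt0//.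
  have -> : 2 ^+ k = Num.sqrt (4 ^+ k) :> R.
    by rewrite -[4]/(2 * 2)%:R natrM -expr2 -exprM mulnC exprM sqrtr_sqr ger0_norm ?exprn_ge0.
  by rewrite -sqrtrM ?sqr_ge0// ler_sqrt// mulrC.
have cv x (Dx : D x) := geometric_cvg (sqrtr_ge0 _) (gh x Dx).
have mg k : measurable_fun D (g_ k).
  apply/measurable_restrict => //; first exact: measurableD.
  by have [mf _] := sf k; exact: measurable_funS mf.
pose f x := limn (g_ ^~ x).
have mf : measurable_fun D f.
  by apply: (measurable_fun_cvg mg) => x Dx; exact: (cv x Dx).1.
have aeg : {ae mu, forall x, D x -> forall k, g_ k x = f_ k x}.
  exists N; split=> // x /= /not_implyP[Dx] /existsNP[k].
  rewrite /g_ /restrict in_setD mem_set//=.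
  by have [/set_mem//|] := boolP (x \in N).
have sgf k : intg (fun x => (g_ k x - f x) ^+ 2).
  have i4 : intg (fun x => 4 * h x) by exact: intgZ.
  apply: le_intg i4 => //; first by apply: measurable_funX; exact: measurable_funB.
  move=> x Dx; rewrite normrX.
  have := (cv x Dx).2 k; rewrite -/(f x) => /= gf.
  have gf' : `|g_ k x - f x| <= 2 * Num.sqrt (h x).
    apply: (le_trans gf); rewrite ler_piMr ?mulr_ge0 ?sqrtr_ge0//.
    by rewrite exprn_ile1// ?invr_ge0// invf_le1// ler1n.
  have -> : 4 * h x = (2 * Num.sqrt (h x)) ^+ 2.
    by rewrite exprMn sqr_sqrtr// -natrX.
  by rewrite lerXn2r ?nnegrE ?mulr_ge0 ?sqrtr_ge0.
have sg k : sqint mu D (g_ k).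
  have [mfk ifk] := sf k; split=> //; apply: ae_eq_intg ifk => //.
    exact: measurable_funX.
  by apply: filterS aeg => x /[apply] ->.
exists f.
  have -> : f = (fun x => g_ 0%N x - (g_ 0%N x - f x)).
    by apply/funext => x; rewrite subKr.
  apply: sqintB => //; split=> //; exact: measurable_funB.
have eqI : (fun k => Int (fun x => (f_ k x - f x) ^+ 2)) =
    (fun k => Int (fun x => (g_ k x - f x) ^+ 2)).
  apply/funext => k; apply: ae_eq_Int => //.
  - by apply: measurable_funX; apply: measurable_funB => //; have [] := sf k.
  - by apply: measurable_funX; exact: measurable_funB.
  - by apply: filterS aeg => x /[apply] ->.
rewrite eqI.
have := @dominated_Int _ _ _ mu D mD (fun k x => (g_ k x - f x) ^+ 2) (cst 0)
  (fun x => 4 * h x) _ _ _ _ _.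
rewrite Rintegral_cst// mul0r; case => //.
- by move=> k; apply: measurable_funX; exact: measurable_funB.
- apply: aeW => x Dx.
  have gf0 : (fun n => g_ n x - f x) @ \oo --> (0 : R).
    rewrite -[X in _ --> X](subrr (f x)); apply: cvgB; last exact: cvg_cst.
    exact: (cv x Dx).1.
  rewrite -[X in _ --> X](mulr0 (0 : R)); exact: (cvgM gf0 gf0).
- exact: intgZ.
move=> k; apply: aeW => x Dx; rewrite normrX.
have := (cv x Dx).2 k; rewrite -/(f x) => /= gf.
have gf' : `|g_ k x - f x| <= 2 * Num.sqrt (h x).
  apply: (le_trans gf); rewrite ler_piMr ?mulr_ge0 ?sqrtr_ge0//.
  by rewrite exprn_ile1// ?invr_ge0// invf_le1// ler1n.
have -> : 4 * h x = (2 * Num.sqrt (h x)) ^+ 2.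
  by rewrite exprMn sqr_sqrtr// -natrX.
by rewrite lerXn2r ?nnegrE ?mulr_ge0 ?sqrtr_ge0.
Qed.

End L2_completeness.

Lemma ae_le_intg d (T : measurableType d) (R : realType)
    (mu : {measure set T -> \bar R}) (D : set T) (mD : measurable D) (f g : T -> R) :
  measurable_fun D f -> {ae mu, forall x, D x -> `|f x| <= g x} ->
  mu.-integrable D (EFin \o g) -> mu.-integrable D (EFin \o f).
Proof.
move=> mf fg ig; have mg : measurable_fun D g by exact: intg_measurable ig.
have /integrableP[mf' _] := ig.
apply/integrableP; split; first exact/measurable_EFinP.
apply: le_lt_trans (integrable_lty mD (integrable_norm ig)).
apply: ae_ge0_le_integral => //.
- by apply: measurableT_comp => //; exact/measurable_EFinP.
- by move=> x _; rewrite /= lee_fin.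
- by apply/measurable_EFinP; apply: measurableT_comp.
- apply: ae_in_imply fg => x Dx fgx.
  by rewrite /= lee_fin (le_trans fgx)// ler_norm.
Qed.

Lemma measurable_comp1 d (T : measurableType d) (R : realType) (D : set T)
    (F : R -> R) (f : T -> R) :
  measurable_fun setT F -> measurable_fun D f -> measurable_fun D (fun x => F (f x)).
Proof. exact: measurableT_comp. Qed.

Lemma intg_sqrM d (T : measurableType d) (R : realType)
    (mu : {measure set T -> \bar R}) (D : set T) (mD : measurable D)
    (t S : T -> R) :
  measurable_fun D t -> (forall x, `|t x| <= 2) ->
  mu.-integrable D (EFin \o S) -> (forall x, 0 <= S x) ->
  mu.-integrable D (EFin \o (fun x => t x ^+ 2 * S x)).
Proof.
move=> mt t2 iS S0; apply: (le_intg mD _ _ (intgZ mD 4 iS)).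
  apply: measurable_funM; last exact: intg_measurable iS.
  exact: measurable_funX.
move=> x _; rewrite normrM (ger0_norm (S0 x)) ler_wpM2r// normrX.
by have := t2 x; have := normr_ge0 (t x); nra.
Qed.

(** Used with S = |grad u|^2, to replace a bounded factor of a gradient by its
    pointwise limit. *)
Lemma Int_sqrM_cvg0 d (T : measurableType d) (R : realType)
    (mu : {measure set T -> \bar R}) (D : set T) (mD : measurable D)
    (t : nat -> T -> R) (S : T -> R) :
  (forall k, measurable_fun D (t k)) -> (forall k x, `|t k x| <= 2) ->
  {ae mu, forall x, D x -> t ^~ x @ \oo --> (0 : R)} ->
  mu.-integrable D (EFin \o S) -> (forall x, 0 <= S x) ->
  (fun k => \int[mu]_(x in D) (t k x ^+ 2 * S x)) @ \oo --> (0 : R).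
Proof.
move=> mt t2 tcv iS S0.
have mS : measurable_fun D S by have /measurable_int/measurable_EFinP := iS.
have [|||//|k|_] := @dominated_Int _ _ _ mu D mD (fun k x => t k x ^+ 2 * S x) (cst 0)
  (fun x => 4 * S x).
- by move=> k; apply: measurable_funM => //; exact: measurable_funX.
- exact: measurable_cst.
- apply: filterS tcv => x /[apply] tx.
  have h : (fun k => t k x * t k x * S x) @ \oo --> (0 * 0 * S x : R).
    by apply: cvgMl; exact: (cvgM tx tx).
  by move: h; rewrite !mul0r.
- exact: (intgZ mD 4 iS).
- apply: aeW => x Dx; rewrite normrM (ger0_norm (S0 x)) ler_wpM2r// normrX.
  by have := t2 k x; have := normr_ge0 (t k x); nra.
by rewrite Rintegral_cst// mul0r.
Qed.

(** * Lebesgue measure on R^N *)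

Section lebesgue_Rn.
Context {R : realType} {n : nat}.
Local Notation V := 'rV[R]_n.+1.
Local Notation mu := (lebesgue R n).
Implicit Types (x y h : V) (A X U : set V).

Lemma lebesgue_outer_le A (B : nat -> V * V) : A `<=` \bigcup_k box (B k) ->
  (lebesgue_outer A <= \sum_(0 <= k <oo) (box_vol (B k))%:E)%E.
Proof. by move=> AB; apply: ereal_inf_lbound; exists B. Qed.

(** A hyperplane cuts every box of a cover into two boxes whose volumes add up. *)
Lemma halfspace_measurable (i : 'I_n.+1) (c : R) :
  measurable ([set x : V | c < x 0 i] : set (Rn R n)).
Proof.
pose up (ab : V * V) : V * V :=
  (\row_j (if j == i then Num.max (ab.1 0 j) c else ab.1 0 j), ab.2).
pose lo (ab : V * V) : V * V :=
  (ab.1, \row_j (if j == i then Num.min (ab.2 0 j) c else ab.2 0 j)).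
have volE ab : box_vol (up ab) + box_vol (lo ab) = box_vol ab.
  rewrite /box_vol (bigD1 i)//= [X in _ + X](bigD1 i)//= [RHS](bigD1 i)//=.
  have -> : \prod_(j < n.+1 | j != i) Num.max 0 (ab.2 0 j - (up ab).1 0 j) =
      \prod_(j < n.+1 | j != i) Num.max 0 (ab.2 0 j - ab.1 0 j).
    by apply: eq_bigr => j ji; rewrite !mxE (negbTE ji).
  have -> : \prod_(j < n.+1 | j != i) Num.max 0 ((lo ab).2 0 j - ab.1 0 j) =
      \prod_(j < n.+1 | j != i) Num.max 0 (ab.2 0 j - ab.1 0 j).
    by apply: eq_bigr => j ji; rewrite !mxE (negbTE ji).
  rewrite -mulrDl !mxE eqxx; congr (_ * _).
  move: (ab.1 0 i) (ab.2 0 i) => a b; rewrite !maxElt !minElt.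
  by case: (ltP a c) => ?; case: (ltP b c) => ?; repeat case: ltP => ?; lra.
apply: le_caratheodory_measurable => X.
apply: le_ereal_inf_tmp => _ [B XB <-].
have -> : (\sum_(0 <= k <oo) (box_vol (B k))%:E = \sum_(0 <= k <oo)
    (box_vol (up (B k)))%:E + \sum_(0 <= k <oo) (box_vol (lo (B k)))%:E)%E.
  rewrite -nneseriesD => [|k _ _|k _ _]; [|exact: box_vol_ge0..].
  by apply: eq_eseriesr => k _; rewrite -EFinD volE.
apply: leeD; apply: lebesgue_outer_le => x [/XB[k _ xB] /= xc].
  exists k => //= j; have := xB j; rewrite !mxE; case: eqP => // ->.
  by case/andP => h1 h2; rewrite gt_max h1 xc.
exists k => //= j; have := xB j; rewrite !mxE; case: eqP => // ->.
by case/andP => h1 h2; rewrite le_min h1 h2 /= leNgt; apply/negP.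
Qed.

Lemma box_measurable (ab : V * V) : measurable (box ab : set (Rn R n)).
Proof.
have -> : box ab = \bigcap_(i in [set: 'I_n.+1])
    ([set x : V | ab.1 0 i < x 0 i] `&` ~` [set x : V | ab.2 0 i < x 0 i]).
  apply/seteqP; split=> x /= xab i => [_|].
    by have /andP[h1 h2] := xab i; split=> //=; apply/negP; rewrite -leNgt.
  by have [//|/= h1 /negP] := xab i _; rewrite -leNgt h1 => ->.
apply: fin_bigcap_measurable => [|i _]; first exact: finite_finset.
by apply: measurableI; last apply: measurableC; exact: halfspace_measurable.
Qed.

(** An open set is the union of the boxes with rational corners that it contains. *)
Lemma open_measurable_Rn U : open U -> measurable (U : set (Rn R n)).
Proof.
move=> oU; pose Q := ('rV[rat]_n.+1 * 'rV[rat]_n.+1)%type.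
pose bx (q : Q) := box (map_mx ratr q.1 : V, map_mx ratr q.2 : V).
have -> : U = \bigcup_(q in [set: Q]) (if `[< bx q `<=` U >] then bx q else set0).
  apply/seteqP; split=> [x Ux|x [q _]]; last by case: asboolP => // h /h.
  have /nbhs_ballP[e /= e0 eU] : nbhs x U by exact: open_nbhs_nbhs.
  have ql i : exists q : rat, ratr q \in `]x 0 i - e, x 0 i[.
    by apply: rat_in_itvoo; rewrite ltrBlDr ltrDl.
  have qr i : exists q : rat, ratr q \in `]x 0 i, x 0 i + e[.
    by apply: rat_in_itvoo; rewrite ltrDl.
  have [l lP] := choice ql; have [r rP] := choice qr.
  exists (\row_i l i, \row_i r i) => //.
  case: asboolP => [_|[]].
    move=> i /=; rewrite !mxE; have := lP i; have := rP i; rewrite !in_itv/=.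
    by move=> /andP[+ _] /andP[_]; move=> /ltW -> ->.
  move=> y /= yb; apply: eU; split=> // i j; rewrite ord1.
  have := yb j; rewrite /= !mxE; have := lP j; have := rP j; rewrite !in_itv/=.
  move=> /andP[h1 h2] /andP[h3 h4] /andP[h5 h6].
  by rewrite /ball/= ltr_norml; apply/andP; split; lra.
apply: countable_bigcupT_measurable => [|q]; first exact: countableP.
by case: ifP => _; [exact: box_measurable|exact: measurable0].
Qed.

Lemma continuous_measurable_Rn (D : set (Rn R n)) (f : V -> R) :
  continuous f -> measurable D -> measurable_fun D (f : Rn R n -> R).
Proof.
move=> cf mD.
apply: (measurability _ (RGenOpens.measurableE R)).
move=> _ [_ [a [b ->] <-]]; apply: measurableI => //.
by apply: open_measurable_Rn; move/continuousP : cf; apply; exact: interval_open.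
Qed.

Lemma lebesgue_box_lty (ab : V * V) : (mu (box ab) < +oo)%E.
Proof.
apply: (@le_lt_trans _ _ (\sum_(0 <= k <oo)
   (if k == 0%N then box_vol ab else 0)%:E)%E); last first.
  rewrite (nneseriesD1 (n := 0%N))//; last first.
    by move=> k _; case: ifP => // _; exact: box_vol_ge0.
  rewrite eseries0 ?adde0 ?ltry// => k _ /= /negbTE -> //.
apply: le_trans (_ : (_ <= \sum_(0 <= k <oo)
    (box_vol (if k == 0%N then ab else (0, 0)))%:E)%E) _.
  by apply: lebesgue_outer_le => x xab; exists 0%N.
apply: lee_nneseries => k *; first exact: box_vol_ge0.
case: ifP => // _; rewrite lee_fin /box_vol big_ord_recl subrr maxxx mul0r//.
Qed.

Lemma lebesgue_bounded_lty A : bounded_set A -> (mu A < +oo)%E.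
Proof.
move=> [M [_ /(_ (`|M| + 1))]]; rewrite (le_lt_trans (ler_norm _)) ?ltrDl// => /(_ isT).
set K := `|M| + 1 => AK.
apply: le_lt_trans (lebesgue_box_lty (const_mx (- (K + 1)), const_mx K)).
apply: le_lebesgue_outer => x /AK xK i /=; rewrite !mxE.
have : `|x 0 i| <= K.
  apply: le_trans xK; rewrite [leRHS]/Num.norm /= mx_normrE.
  by apply/bigmax_geP; right; exists (0, i).
by rewrite ler_norml => /andP[? ?]; apply/andP; split; lra.
Qed.

Definition translate h : Rn R n -> Rn R n := fun x => (x : V) + h.

(** Translating a cover by boxes preserves the volumes. *)
Lemma lebesgue_outer_translate h A : lebesgue_outer (translate h @^-1` A) = lebesgue_outer A.
Proof.
suff le h' A' : (lebesgue_outer (translate h' @^-1` A') <= lebesgue_outer A')%E.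
  apply/eqP; rewrite eq_le le/=.
  have := le (- h) (translate h @^-1` A).
  rewrite (_ : translate (- h) @^-1` (translate h @^-1` A) = A)//.
  by apply/seteqP; split=> x; rewrite /translate/= addrNK.
apply: le_ereal_inf_tmp => _ [B AB <-].
pose tr (ab : V * V) := (ab.1 - h', ab.2 - h').
have -> : (\sum_(0 <= k <oo) (box_vol (B k))%:E =
           \sum_(0 <= k <oo) (box_vol (tr (B k)))%:E)%E.
  apply: eq_eseriesr => k _; congr (_%:E); apply: eq_bigr => i _ /=.
  by rewrite !mxE; congr Num.max; lra.
apply: lebesgue_outer_le => x /AB[k _ xB]; exists k => // i.
have := xB i; rewrite /translate /= !mxE => /andP[? ?]; apply/andP; split; lra.
Qed.

Lemma measurable_translate h : measurable_fun [set: Rn R n] (translate h).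
Proof.
move=> _ A mA; rewrite setTI; change ((@lebesgue_outer R n).-caratheodory (translate h @^-1` A)) => X.
rewrite -(lebesgue_outer_translate (- h) X) -(lebesgue_outer_translate (- h) (X `&` _)).
rewrite -(lebesgue_outer_translate (- h) (X `&` ~` _)) (mA (translate (- h) @^-1` X)).
have E (x : V) : translate h (translate (- h) x) = x by rewrite /translate/= addrNK.
by congr (_ + _)%E; apply: (congr1 lebesgue_outer); apply/seteqP; split => x /= [];
  rewrite ?E.
Qed.

Lemma Rintegral_translate h (f : V -> R) : mu.-integrable setT (EFin \o f) ->
  mu.-integrable setT (EFin \o (fun x => f (x + h))) /\
  \int[mu]_x f (x + h) = \int[mu]_x f x.
Proof.
move=> fi; have mf := measurable_int _ fi.
have E (g : Rn R n -> \bar R) : measurable_fun setT g -> (forall x, 0 <= g x)%E ->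
    (\int[mu]_x g (translate h x) = \int[mu]_x g x)%E.
  move=> mg g0.
  have := ge0_integral_pushforward (measurable_translate h) mu measurableT mg (in1W g0).
  rewrite preimage_setT => <-; apply: eq_measure_integral.
    exact: measurable_translate.
  by move=> ? A mA _; exact: (lebesgue_outer_translate h A).
split.
  apply/integrableP; split.
    by apply: (measurableT_comp mf); exact: measurable_translate.
  have mabs : measurable_fun setT (fun x : Rn R n => `|(EFin \o f) x|)%E.
    exact: measurableT_comp.
  move/integrableP : fi => [_]; apply: le_lt_trans.
  by rewrite -(E _ mabs).

congr fine; rewrite integralE [RHS]integralE.
congr (_ - _)%E.
  apply: etrans (E _ (measurable_funepos mf) (funepos_ge0 _)).
  by apply: eq_integral => x _; rewrite !funeposE.
apply: etrans (E _ (measurable_funeneg mf) (funeneg_ge0 _)).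
by apply: eq_integral => x _; rewrite !funenegE.
Qed.

End lebesgue_Rn.

(** * The integral of a partial derivative *)

Section integral_partial.
Context {R : realType} {n : nat}.
Local Notation V := 'rV[R]_n.+1.
Local Notation mu := (lebesgue R n).
Implicit Types (x y h : V) (K Omega : set V) (psi : V -> R).

Lemma cont_cst (c : R) : continuous (fun _ : V => c).
Proof. by move=> x; exact: cst_continuous. Qed.

Lemma contD (f g : V -> R) : continuous f -> continuous g ->
  continuous (fun x => f x + g x).
Proof. by move=> cf cg x; exact: (@continuousD _ _ _ f g x (cf x) (cg x)). Qed.

Lemma contM (f g : V -> R) : continuous f -> continuous g ->
  continuous (fun x => f x * g x).
Proof. by move=> cf cg x; exact: (@continuousM _ _ f g x (cf x) (cg x)). Qed.

Lemma contB (f g : V -> R) : continuous f -> continuous g ->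
  continuous (fun x => f x - g x).
Proof. by move=> cf cg x; exact: (@continuousB _ _ _ f g x (cf x) (cg x)). Qed.

Lemma cont_comp (f : V -> R) (F : R -> R) : continuous f -> continuous F ->
  continuous (fun x => F (f x)).
Proof. by move=> cf cF x; exact: (@continuous_comp _ _ _ f F x (cf x) (cF _)). Qed.

Lemma cont_translate (f : V -> R) h : continuous f -> continuous (fun x => f (x + h)).
Proof.
move=> cf x; apply: (@continuous_comp _ _ _ (fun x : V => x + h) f x) (cf _).
exact: (@continuousD _ _ _ id (fun _ : V => h) x (fun A => id) (@cst_continuous _ _ h x)).
Qed.

Lemma diff_quotient_line psi x h (t : R) :
  (fun k : R => k^-1 *: (((fun t => psi (t *: h + x)) \o shift t) (k *: 1) -
                          psi (t *: h + x))) =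
  (fun k : R => k^-1 *: ((psi \o shift (t *: h + x)) (k *: h) - psi (t *: h + x))).
Proof.
apply/funext => k; congr (_ *: (psi _ - _)).
by rewrite /shift/= scalerDl addrA [k *: (1 : R)]mulr1.
Qed.

Lemma is_derive_line psi x h (t : R) : derivable psi (t *: h + x) h ->
  is_derive t 1 (fun t => psi (t *: h + x)) ('D_h psi (t *: h + x)).
Proof.
move=> dpsi; apply: DeriveDef.
  by rewrite /derivable diff_quotient_line; exact: dpsi.
by rewrite /derive diff_quotient_line.
Qed.

(** The mean value theorem along a line. *)
Lemma line_increment_le psi h (M : R) : (forall x, derivable psi x h) ->
  (forall x, `|'D_h psi x| <= M) -> forall x (t : R), 0 < t ->
  `|psi (t *: h + x) - psi x| <= M * t.
Proof.
move=> dpsi bM x t t0.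
have isd (u : R) : is_derive u 1 (fun t => psi (t *: h + x)) ('D_h psi (u *: h + x)).
  exact/is_derive_line/dpsi.
have cont : {within `[0, t], continuous (fun t : R => psi (t *: h + x))}.
  by apply: derivable_within_continuous => u _; have [] := isd u.
have [c _] := MVT t0 (fun u _ => isd u) cont.
rewrite scale0r add0r subr0 => ->.
by rewrite normrM (gtr0_norm t0) ler_wpM2r// ltW.
Qed.

Lemma derive_off_support psi K h x : closed K -> (forall y, ~ K y -> psi y = 0) ->
  ~ K x -> 'D_h psi x = 0.
Proof.
move=> cK K0 Kx.
have nK : \forall y \near x, psi y = 0.
  have : nbhs x (~` K) by apply: open_nbhs_nbhs; split=> //; exact: closed_openC.
  by apply: filterS => y /K0.
rewrite -(@derive_cst _ _ _ (0 : R) x h).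
exact: near_eq_derive.
Qed.

Lemma continuous_bounded_support psi K : compact K ->
  (forall y, ~ K y -> psi y = 0) -> continuous psi -> exists2 M, 0 <= M & forall x, `|psi x| <= M.
Proof.
move=> cK K0 cpsi.
have : compact (psi @` K).
  by apply: continuous_compact => //; exact: continuous_subspaceT.
move=> /compact_bounded[M [_ /(_ (`|M| + 1))]].
rewrite (le_lt_trans (ler_norm _)) ?ltrDl// => /(_ isT) bM.
exists (`|M| + 1); first by rewrite addr_ge0.
move=> x; have [Kx|/K0 ->] := pselect (K x); last by rewrite normr0 addr_ge0.
by apply: bM; exists x.
Qed.

(** By translation invariance the difference quotients
    q_k = (k + 1) (psi (x + e / (k + 1)) - psi x) have integral 0.  They converge to
    the partial derivative, and are bounded by its supremum on a fixed ball and 0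
    outside. *)
Lemma Rintegral_partial0 Omega K psi (i : 'I_n.+1) :
  measurable (Omega : set (Rn R n)) -> compact K -> K `<=` Omega ->
  (forall y, ~ K y -> psi y = 0) -> continuous psi ->
  (forall x, derivable psi x (delta_mx 0 i)) -> continuous (partial i psi) ->
  \int[mu]_(x in Omega) partial i psi x = 0.
Proof.
move=> mO cK KO K0 cpsi dpsi cdpsi.
have clK : closed K by apply: compact_closed => //; exact: norm_hausdorff.
have dK0 y : ~ K y -> partial i psi y = 0.
  by move=> Ky; exact: derive_off_support Ky.
have -> : \int[mu]_(x in Omega) partial i psi x = \int[mu]_x partial i psi x.
  rewrite Rintegral_mkcond; apply: eq_Rintegral => x _.
  rewrite patchE; case: ifPn => // /negP xO; rewrite dK0// => /KO.
  by move/mem_set.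
have [M M0 bM] := continuous_bounded_support cK K0 cpsi.
have [M' M'0 bM'] := continuous_bounded_support cK dK0 cdpsi.
pose e : V := delta_mx 0 i.
have [C [_ /(_ (`|C| + 1))]] := compact_bounded cK.
rewrite (le_lt_trans (ler_norm _)) ?ltrDl// => /(_ isT) bC.
set C' := `|C| + 1 in bC.
(* The translates of the support by vectors of norm at most |e| stay in B. *)
pose B : set V := [set x | `|x| <= C' + `|e|].
have C'0 : 0 <= C' by rewrite addr_ge0.
have mB : measurable (B : set (Rn R n)).
  rewrite -(setCK B); apply: measurableC; apply: open_measurable_Rn.
  apply: closed_openC; rewrite /B.
  have -> : [set x : V | `|x| <= C' + `|e|] = Num.norm @^-1` [set r : R | r <= C' + `|e|].
    by [].
  by apply: closed_comp; [move=> x _; exact: norm_continuous|exact: closed_le].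
have fB : (mu B < +oo)%E.
  apply: lebesgue_bounded_lty; exists (C' + `|e|); split; first exact: num_real.
  by move=> r /ltW rC x /= xB; exact: le_trans rC.
have iB (N : R) : mu.-integrable setT (EFin \o (fun x : Rn R n => N * \1_B x)).
  have := @intg_cst _ _ _ mu B mB fB N.
  move/(integrable_mkcond _ mB); congr (_.-integrable _ _).
  apply/funext => x; rewrite /patch/= /indic; case: ifPn => xB.
    by rewrite /= mulr1.
  by rewrite /= mulr0.
have ipsi : mu.-integrable setT (EFin \o (psi : Rn R n -> R)).
  apply: (le_intg measurableT _ _ (iB M)); first exact: continuous_measurable_Rn.
  move=> x _; rewrite /indic; case: (boolP (x \in B)) => xB; first by rewrite mulr1.
  rewrite mulr0 K0 ?normr0// => /bC xC; move/negP : xB; apply; rewrite inE /B/=.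
  by rewrite (le_trans xC)// lerDl.
pose q k x := k.+1%:R * (psi (x + k.+1%:R^-1 *: e) - psi x).
have q0 k : \int[mu]_x q k x = 0.
  have [it Et] := Rintegral_translate (k.+1%:R^-1 *: e) ipsi.
  rewrite /q RintegralZl//; last exact: (intgB measurableT it ipsi).
  by rewrite RintegralB// Et subrr mulr0.
have cq k : continuous (q k).
  by apply: contM; [exact: cont_cst|apply: contB => //; exact: cont_translate].
have [] := @dominated_Int _ _ _ mu setT measurableT q (partial i psi)
  (fun x : Rn R n => M' * \1_B x).
- by move=> k; exact: continuous_measurable_Rn.
- exact: continuous_measurable_Rn.
- apply: aeW => x _.
  have dx : (fun k : R => k^-1 *: ((psi \o shift x) (k *: e) - psi x)) @ 0^' -->
    partial i psi x by exact: dpsi.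
  have hn : (forall k : nat, (k.+1%:R^-1 : R) != 0) /\
      (fun k : nat => k.+1%:R^-1 : R) @ \oo --> (0 : R).
    by split; [move=> k; rewrite invr_eq0|exact: cvg_harmonic].
  have := (cvgr_dnbhsP _ _ _).1 dx _ hn.
  apply: cvg_trans; apply: near_eq_cvg; apply: nearW => k /=.
  by rewrite invrK /q (addrC x).
- exact: iB.
- move=> k; apply: aeW => x _; rewrite /indic; case: (boolP (x \in B)) => xB.
    rewrite mulr1 /q normrM ger0_norm// (addrC x) mulrC -ler_pdivlMr//.
    by apply: line_increment_le => //; rewrite invr_gt0.
  have xB' : C' + `|e| < `|x| by rewrite ltNge; apply: contra xB => xB; rewrite inE.
  rewrite mulr0 /q !K0 ?subrr ?mulr0 ?normr0// => /bC => h.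
    by move: xB'; rewrite ltNge (le_trans h)// lerDl.
  move: xB'; rewrite ltNge => /negP; apply.
  rewrite -[x](addrK (k.+1%:R^-1 *: e)) (le_trans (ler_normB _ _))// lerD//.
  by rewrite normrZ ler_piMl// ger0_norm ?invr_ge0// invf_le1// ler1n.
move=> _; under [X in X @ _]eq_fun do rewrite q0.
by move=> /(cvg_lim (@Rhausdorff R)) <-; rewrite lim_cst.
Qed.

End integral_partial.

(** * Smooth functions and the regularized absolute value *)

Section smooth_functions.
Context {R : realType} {n : nat}.
Local Notation V := 'rV[R]_n.+1.
Implicit Types (x : V) (f g : V -> R).

(** The chain rule for a directional derivative, obtained from the one-variable
    chain rule on the line through x. *)
Lemma is_derive_comp1 f (F : R -> R) x (h : V) (a : R) : derivable f x h ->
  is_derive (f x) 1 F a -> is_derive x h (F \o f) (a * 'D_h f x).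
Proof.
move=> df dF.
have x0 : 0 *: h + x = x by rewrite scale0r add0r.
have dg : is_derive (0 : R) 1 (fun t => f (t *: h + x)) ('D_h f x).
  by have := @is_derive_line R n f x h 0; rewrite x0; exact.
have dF' : is_derive (f (0 *: h + x)) 1 F a by rewrite x0.
have [d1 d2] := is_derive1_comp dF' dg.
have E := diff_quotient_line (F \o f) x h 0.
split.
  by move: d1; rewrite /derivable -[F \o _]/(fun t => (F \o f) (t *: h + x)) E x0.
by move: d2; rewrite /derive -[F \o _]/(fun t => (F \o f) (t *: h + x)) E x0.
Qed.

Lemma smoothW f : smooth f -> continuous f /\ forall i x, derivable f x (delta_mx 0 i).
Proof. exact: (fun sf => sf [::]). Qed.

Lemma smooth_partial f i : smooth f -> smooth (partial i f).
Proof. by move=> sf s; have := sf (rcons s i); rewrite foldr_rcons. Qed.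

Lemma smooth_cst (c : R) : smooth (fun _ : V => c).
Proof.
move=> s; rewrite (_ : foldr _ _ _ = fun _ : V => if s is [::] then c else 0).
  by split; [exact: cont_cst|move=> *; exact: derivable_cst].
elim: s => [//|j s IH] /=; rewrite IH; apply/funext => x.
by rewrite /partial; case: s {IH} => [|? ?]; rewrite derive_cst.
Qed.

(** The composite sqrt (f^2 + e^2) is shown to be smooth by embedding it in an
    algebra of C^1 functions that is stable under partial derivatives; the inverse
    square root is adjoined because it occurs in these derivatives. *)
Inductive sqrt_algebra f (e : R) : (V -> R) -> Prop :=
| sqrt_alg_smooth g : smooth g -> sqrt_algebra f e g
| sqrt_algD g h : sqrt_algebra f e g -> sqrt_algebra f e h ->
    sqrt_algebra f e (fun x => g x + h x)
| sqrt_algM g h : sqrt_algebra f e g -> sqrt_algebra f e h ->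
    sqrt_algebra f e (fun x => g x * h x)
| sqrt_alg_sqrt : sqrt_algebra f e (fun x => Num.sqrt (f x ^+ 2 + e ^+ 2))
| sqrt_alg_sqrtV : sqrt_algebra f e (fun x => (Num.sqrt (f x ^+ 2 + e ^+ 2))^-1).

(** A smooth approximation of the absolute value, up to the constant e. *)
Definition smoothabs (e s : R) : R := Num.sqrt (s ^+ 2 + e ^+ 2).

Lemma smoothabs_gt0 (e s : R) : 0 < e -> 0 < smoothabs e s.
Proof. by move=> e0; rewrite sqrtr_gt0 ltr_wpDl ?sqr_ge0 ?exprn_gt0. Qed.

Lemma is_derive_smoothabs (e s : R) : 0 < e ->
  is_derive s 1 (smoothabs e) (s / smoothabs e s).
Proof.
move=> e0; have p : 0 < s ^+ 2 + e ^+ 2 by rewrite ltr_wpDl ?sqr_ge0 ?exprn_gt0.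
have d1 : is_derive s 1 (fun s : R => s ^+ 2 + e ^+ 2) (s + s).
  apply: is_derive_eq; rewrite addr0 /GRing.scale /=.
  ring.
have c : is_derive s 1 (smoothabs e) _ :=
  @is_derive1_comp R Num.sqrt (fun s => s ^+ 2 + e ^+ 2) s _ _ (is_derive1_sqrt p) d1.
apply: is_derive_eq c _; rewrite -/(smoothabs e s).
by have := smoothabs_gt0 s e0; rewrite lt0r => /andP[h _]; field.
Qed.

Lemma is_derive_inv (F : R -> R) (s a : R) : F s != 0 -> is_derive s 1 F a ->
  is_derive s 1 (fun t => (F t)^-1) (- a / F s ^+ 2).
Proof.
move=> F0 dF; apply: (is_derive_eq (is_deriveV F0 dF)).
by rewrite /GRing.scale /=; field.
Qed.

Lemma cont_real_derivable (F : R -> R) :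
  (forall s, derivable F s 1) -> continuous F.
Proof.
by move=> dF s; apply: differentiable_continuous; exact/derivable1_diffP.
Qed.

Lemma sqrt_algebra_C1 f e g : 0 < e -> smooth f -> sqrt_algebra f e g ->
  [/\ continuous g, forall i x, derivable g x (delta_mx 0 i) &
      forall i, sqrt_algebra f e (partial i g)].
Proof.
move=> e0 sf; have [cf df] := smoothW sf.
have dw i x : is_derive x (delta_mx 0 i) (smoothabs e \o f)
    (f x / smoothabs e (f x) * partial i f x).
  by apply: is_derive_comp1 (df i x) _; exact: is_derive_smoothabs.
have dwV i x : is_derive x (delta_mx 0 i) ((fun s => (smoothabs e s)^-1) \o f)
    (- (f x / smoothabs e (f x)) / smoothabs e (f x) ^+ 2 * partial i f x).
  apply: is_derive_comp1 (df i x) _; apply: is_derive_inv.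
    by rewrite gt_eqF// smoothabs_gt0.
  exact: is_derive_smoothabs.
have cw : continuous (smoothabs e).
  by apply: cont_real_derivable => s; have [] := is_derive_smoothabs s e0.
have cwV : continuous (fun s : R => (smoothabs e s)^-1).
  apply: cont_real_derivable => s.
  have := is_derive_inv _ (is_derive_smoothabs s e0).
  by rewrite gt_eqF ?smoothabs_gt0// => /(_ isT) [].
elim=> {g} [g sg|g h _ [cg dg Ig] _ [ch dh Ih]|g h ag [cg dg Ig] ah [ch dh Ih]||].
- have [cg dg] := smoothW sg; split=> // i.
  by apply: sqrt_alg_smooth; exact: smooth_partial.
- split; first exact: contD.
    by move=> i x; exact: (derivableD (dg i x) (dh i x)).
  move=> i; have -> : partial i (fun x => g x + h x) =
      (fun x => partial i g x + partial i h x).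
    by apply/funext => x; exact: (deriveD (dg i x) (dh i x)).
  exact: sqrt_algD.
- split; first exact: contM.
    by move=> i x; exact: (derivableM (dg i x) (dh i x)).
  move=> i; have -> : partial i (fun x => g x * h x) =
      (fun x => g x * partial i h x + h x * partial i g x).
    by apply/funext => x; exact: (deriveM (dg i x) (dh i x)).
  by apply: sqrt_algD; exact: sqrt_algM.
- split; first exact: (cont_comp cf cw).
    by move=> i x; have [] := dw i x.
  move=> i; have -> : partial i (fun x => Num.sqrt (f x ^+ 2 + e ^+ 2)) =
      (fun x => (f x * (Num.sqrt (f x ^+ 2 + e ^+ 2))^-1) * partial i f x).
    by apply/funext => x; have [_] := dw i x.
  apply: sqrt_algM; last by apply: sqrt_alg_smooth; exact: smooth_partial.
  by apply: sqrt_algM; [exact: sqrt_alg_smooth|exact: sqrt_alg_sqrtV].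
- split; first exact: (cont_comp cf cwV).
    by move=> i x; have [] := dwV i x.
  pose w x := (Num.sqrt (f x ^+ 2 + e ^+ 2))^-1.
  have aw : sqrt_algebra f e w by exact: sqrt_alg_sqrtV.
  move=> i; have -> : partial i (fun x => (Num.sqrt (f x ^+ 2 + e ^+ 2))^-1) =
      (fun x => (-1 * (f x * (w x * (w x * w x)))) * partial i f x).
    apply/funext => x; have [_] := dwV i x; rewrite /partial => ->.
    rewrite /w -/(smoothabs e (f x)).
    by have := smoothabs_gt0 (f x) e0; rewrite lt0r => /andP[h _]; field.
  apply: sqrt_algM; last by apply: sqrt_alg_smooth; exact: smooth_partial.
  apply: sqrt_algM.
    by apply: sqrt_alg_smooth; exact: smooth_cst.
  apply: sqrt_algM; first exact: sqrt_alg_smooth.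
  by apply: sqrt_algM => //; exact: sqrt_algM.
Qed.

Lemma sqrt_algebra_smooth f e g : 0 < e -> smooth f -> sqrt_algebra f e g -> smooth g.
Proof.
move=> e0 sf ag s /=.
have : sqrt_algebra f e (foldr partial g s).
  elim: s => //= i s IH; by have [_ _] := sqrt_algebra_C1 e0 sf IH.
by move=> /(sqrt_algebra_C1 e0 sf)[].
Qed.

End smooth_functions.

(** * Test functions and their closure in H^1 *)

Lemma young_weighted (R : realFieldType) (y z d : R) : 0 < d ->
  `|y * z| <= d^-1 * y ^+ 2 + d * z ^+ 2.
Proof.
move=> d0; have dVp : 0 < d^-1 by rewrite invr_gt0.
have E : d^-1 * y ^+ 2 + d * z ^+ 2 - 2 * (y * z) = d^-1 * (y - d * z) ^+ 2.
  by field; rewrite gt_eqF.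
have E' : d^-1 * y ^+ 2 + d * z ^+ 2 + 2 * (y * z) = d^-1 * (y + d * z) ^+ 2.
  by field; rewrite gt_eqF.
have h1 : 0 <= d^-1 * (y - d * z) ^+ 2 by rewrite mulr_ge0 ?sqr_ge0 ?ltW.
have h2 : 0 <= d^-1 * (y + d * z) ^+ 2 by rewrite mulr_ge0 ?sqr_ge0 ?ltW.
have h3 : 0 <= d^-1 * y ^+ 2 + d * z ^+ 2.
  by rewrite addr_ge0// mulr_ge0 ?sqr_ge0 ?ltW.
by rewrite ler_norml; apply/andP; split; lra.
Qed.

Section sobolev_tools.
Context {R : realType} {n : nat}.
Local Notation V := 'rV[R]_n.+1.
Local Notation mu := (lebesgue R n).
Variable Omega : set V.
Hypothesis oO : open Omega.
Hypothesis bO : bounded_set Omega.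
Local Notation Int f := (\int[mu]_(x in Omega) f x)%R.
Local Notation intg f := (mu.-integrable Omega (EFin \o f)).
Local Notation sq f := (sqint mu Omega f).
Local Notation test := (test_function Omega).
Implicit Types (f phi psi : Rn R n -> R) (G : 'I_n.+1 -> Rn R n -> R).

Let mO : measurable (Omega : set (Rn R n)). Proof. exact: open_measurable_Rn. Qed.
Let fO : (mu Omega < +oo)%E. Proof. exact: lebesgue_bounded_lty. Qed.

Lemma test_C1 phi : test phi -> [/\ continuous (phi : V -> R),
  forall i x, derivable (phi : V -> R) x (delta_mx 0 i) &
  forall i, continuous (partial i phi)].
Proof.
move=> [sp _ _]; have [cp dp] := smoothW sp; split=> // i.
by have [] := smoothW (smooth_partial i sp).
Qed.

Lemma test_off phi x : ~ closure [set x | phi x != 0] x -> phi x = 0.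
Proof. by move=> nx; apply: contrapT => /eqP p0; apply: nx; exact: subset_closure. Qed.

Lemma test_bounded phi : test phi -> exists2 M, 0 <= M & forall x, `|phi x| <= M.
Proof.
move=> tp; have [cp _ _] := test_C1 tp; have [_ cS _] := tp.
exact: continuous_bounded_support cS (@test_off phi) cp.
Qed.

Lemma test_partial_bounded phi i : test phi ->
  exists2 M, 0 <= M & forall x, `|partial i phi x| <= M.
Proof.
move=> tp; have [_ _ cp] := test_C1 tp; have [_ cS _] := tp.
apply: continuous_bounded_support cS _ (cp i) => y Ky.
apply: derive_off_support (@test_off phi) Ky.
exact: closed_closure.
Qed.

Lemma test_sq phi : test phi -> sq phi.
Proof.
move=> tp; have [M _ bM] := test_bounded tp; have [cp _ _] := test_C1 tp.
apply: (sqint_bounded mO fO (M := M)) => //; exact: continuous_measurable_Rn.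
Qed.

Lemma test_partial_sq phi i : test phi -> sq (partial i phi).
Proof.
move=> tp; have [M _ bM] := test_partial_bounded i tp; have [_ _ cp] := test_C1 tp.
apply: (sqint_bounded mO fO (M := M)) => //; exact: continuous_measurable_Rn.
Qed.

(** The product phi psi is C^1 with compact support in Omega. *)
Lemma test_parts phi psi i : test phi -> test psi ->
  Int (fun x => phi x * partial i psi x) = - Int (fun x => partial i phi x * psi x).
Proof.
move=> tp tq; have [cp dp cdp] := test_C1 tp; have [cq dq cdq] := test_C1 tq.
have [_ cS SO] := tp.
have E : partial i (fun x => phi x * psi x) =
    (fun x => phi x * partial i psi x + partial i phi x * psi x).
  apply/funext => x; apply: etrans (deriveM (dp i x) (dq i x)) _.
  by congr (_ + _); rewrite mulrC.
have := Rintegral_partial0 (psi := fun x => phi x * psi x) (i := i) mO cS SO _ _ _ _.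
rewrite E => I0; apply/eqP; rewrite -addr_eq0 -RintegralD//.
- apply/eqP; apply: I0.
  + by move=> y /test_off ->; rewrite mul0r.
  + exact: contM.
  + by move=> x; exact: (derivableM (dp i x) (dq i x)).
  + by apply: contD; exact: contM.
- by apply: intgM => //; [exact: test_sq|exact: test_partial_sq].
- by apply: intgM => //; [exact: test_partial_sq|exact: test_sq].
Qed.

Lemma smooth_lin phi psi c : smooth (phi : V -> R) -> smooth (psi : V -> R) ->
  smooth (fun x : V => phi x + c * psi x).
Proof.
move=> sp sq s.
suff -> : foldr partial (fun x : V => phi x + c * psi x) s =
    (fun x => foldr partial phi s x + c * foldr partial psi s x).
  have [cp dp] := sp s; have [cq dq] := sq s; split.
    by apply: contD => //; apply: contM => //; exact: cont_cst.
  by move=> i x; exact: (derivableD (dp i x) (derivableZ (dq i x))).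
elim: s => //= i s ->; apply/funext => x.
have [cp dp] := sp s; have [cq dq] := sq s.
by rewrite /partial; apply: etrans (deriveD (dp i x) (derivableZ (dq i x))) _;
  rewrite deriveZ.
Qed.

Lemma partial_lin phi psi c i x : test phi -> test psi ->
  partial i (fun x : V => phi x + c * psi x) x = partial i phi x + c * partial i psi x.
Proof.
move=> tp tq; have [cp dp cdp] := test_C1 tp; have [cq dq cdq] := test_C1 tq.
by rewrite /partial; apply: etrans (deriveD (dp i x) (derivableZ (dq i x))) _;
  rewrite deriveZ.
Qed.

Lemma test_support phi psi : test phi -> smooth (psi : V -> R) ->
  (forall x, phi x = 0 -> psi x = 0) -> test psi.
Proof.
move=> [_ cS SO] sp pp.
have sub : closure [set x : V | psi x != 0] `<=` closure [set x : V | phi x != 0].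
  by apply: closure_subset => x /=; apply: contra => /eqP/pp ->.
split=> //; last exact: subset_trans SO.
by apply: subclosed_compact cS _ => //; exact: closed_closure.
Qed.

Lemma test_lin phi psi c : test phi -> test psi -> test (fun x => phi x + c * psi x).
Proof.
move=> [sp cSp SOp] [sq cSq SOq].
have sub : closure [set x : V | phi x + c * psi x != 0] `<=`
    closure [set x : V | phi x != 0] `|` closure [set x : V | psi x != 0].
  rewrite -closureU; apply: closure_subset => x /= h.
  have [p0|p0] := eqVneq (phi x) 0; last by left.
  by right; apply: contra_neq h => ->; rewrite p0 mulr0 addr0.
split; first exact: smooth_lin.
- apply: subclosed_compact sub; first exact: closed_closure.
  exact: compactU.
- by move=> x /sub[/SOp|/SOq].
Qed.

Lemma test_smoothabs phi e : 0 < e -> test phi ->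
  test (fun x => smoothabs e (phi x) - e) /\
  forall i x, partial i (fun x => smoothabs e (phi x) - e) x =
    phi x / smoothabs e (phi x) * partial i phi x.
Proof.
move=> e0 tp; have [cp dp cdp] := test_C1 tp.
have sp : smooth (phi : V -> R) by case: tp.
split.
  apply: test_support tp _ _.
    apply: (sqrt_algebra_smooth e0 sp).
    apply: sqrt_algD; first exact: sqrt_alg_sqrt.
    by apply: sqrt_alg_smooth; exact: smooth_cst.
  by move=> x ->; rewrite /smoothabs expr0n add0r sqrtr_sqr gtr0_norm// subrr.
move=> i x.
have [d1 d2] := is_derive_comp1 (dp i x) (is_derive_smoothabs (phi x) e0).
rewrite /partial -d2.
apply: etrans (deriveD d1 (derivable_cst _ _ _)) _.
by rewrite derive_cst addr0.
Qed.


Lemma EInt f : intg f -> (\int[mu]_(x in Omega) (f x)%:E)%E = (Int f)%:E.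
Proof. by move=> fi; rewrite /Rintegral fineK//; exact: integrable_fin_num. Qed.

(** The squared distance in H^1, for pairs of a function and a candidate gradient. *)
Definition h1_dist f G f' G' : R :=
  Int (fun x => (f x - f' x) ^+ 2 + \sum_(i < n.+1) (G i x - G' i x) ^+ 2).

Definition sqpair f G := sq f /\ forall i, sq (G i).

Lemma h1_dist_intg f G f' G' : sqpair f G -> sqpair f' G' ->
  intg (fun x => (f x - f' x) ^+ 2 + \sum_(i < n.+1) (G i x - G' i x) ^+ 2).
Proof.
move=> [sf sG] [sf' sG']; apply: intgD => //; first by have [] := sqintB mO sf sf'.
by apply: intg_sum => // i; have [] := sqintB mO (sG i) (sG' i).
Qed.

Lemma h1_dist_triangle f G f' G' f'' G'' : sqpair f G -> sqpair f' G' -> sqpair f'' G'' ->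
  h1_dist f G f'' G'' <= 2 * h1_dist f G f' G' + 2 * h1_dist f' G' f'' G''.
Proof.
move=> s s' s''; rewrite -!RintegralZl//; [|exact: h1_dist_intg..].
rewrite -RintegralD//; [|apply: intgZ => //; exact: h1_dist_intg..].
apply: le_Rintegral => //; first exact: h1_dist_intg.
  by apply: intgD => //; apply: intgZ => //; exact: h1_dist_intg.
have sqle (a b c : R) : (a - c) ^+ 2 <= 2 * (a - b) ^+ 2 + 2 * (b - c) ^+ 2.
  by have := sqr_ge0 (a - 2 * b + c); nra.
move=> x _; rewrite !mulrDr addrACA; apply: lerD; first exact: sqle.
by rewrite !mulr_sumr -big_split/=; apply: ler_sum => i _; exact: sqle.
Qed.

Lemma h1_dist_fun f G f' G' : sqpair f G -> sqpair f' G' ->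
  Int (fun x => (f x - f' x) ^+ 2) <= h1_dist f G f' G'.
Proof.
move=> s s'; apply: le_Rintegral => //; last 2 first.
- exact: h1_dist_intg.
- by move=> x _; rewrite lerDl; apply: sumr_ge0 => i _; rewrite sqr_ge0.
by have [] := sqintB mO s.1 s'.1.
Qed.

Lemma h1_dist_grad f G f' G' i : sqpair f G -> sqpair f' G' ->
  Int (fun x => (G i x - G' i x) ^+ 2) <= h1_dist f G f' G'.
Proof.
move=> s s'; apply: le_Rintegral => //; last 2 first.
- exact: h1_dist_intg.
- move=> x _; rewrite (bigD1 i)//= addrCA lerDl addr_ge0 ?sqr_ge0//.
  by apply: sumr_ge0 => j _; rewrite sqr_ge0.
by have [] := sqintB mO (s.2 i) (s'.2 i).
Qed.

(** Membership in H^1_0 of a function f with gradient G; see [mkH10]. *)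
Definition adherent f G := forall e : R, 0 < e ->
  exists2 phi, test phi & h1_dist f G phi (fun i => partial i phi) < e.

Lemma test_sqpair phi : test phi -> sqpair phi (fun i => partial i phi).
Proof. by move=> tp; split=> [|i]; [exact: test_sq|exact: test_partial_sq]. Qed.

(** Integration by parts is exact for the approximants phi of f.  With
    h1_dist f G phi < d^2, the error is at most
    d^(-1) h1_dist + d (|psi|^2 + |d_i psi|^2) = O(d). *)
Lemma adherent_parts f G : sqpair f G -> adherent f G -> forall psi i, test psi ->
  Int (fun x => f x * partial i psi x) = - Int (fun x => G i x * psi x).
Proof.
move=> s afG psi i tp; have [sp sdp] := test_sqpair tp.
pose C := Int (fun x => partial i psi x ^+ 2) + Int (fun x => psi x ^+ 2).
have C0 : 0 <= C.
  by apply: addr_ge0; apply: Rintegral_ge0 => x _; rewrite sqr_ge0.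
set a := (X in X = _); set b := (X in _ = - X).
suff small d : 0 < d -> `|a + b| <= d * (2 + C).
  apply/eqP; rewrite -addr_eq0 -normr_le0; apply/ler_addgt0Pr => e e0.
  rewrite add0r; have C2 : 0 < 2 + C by rewrite ltr_wpDr.
  by have := small _ (divr_gt0 e0 C2); rewrite divfK ?gt_eqF.
move=> d0; have [|phi tf hd] := afG (d ^+ 2); first by rewrite exprn_gt0.
have [sf sdf] := test_sqpair tf.
have i1 := intgM mO (sqintB mO s.1 sf) (sdp i).
have i2 := intgM mO (sqintB mO (s.2 i) (sdf i)) sp.
have j1 := intgM mO s.1 (sdp i).
have j2 := intgM mO sf (sdp i).
have j3 := intgM mO (s.2 i) sp.
have j4 := intgM mO (sdf i) sp.
have -> : a + b = Int (fun x => (f x - phi x) * partial i psi x +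
                              (G i x - partial i phi x) * psi x).
  rewrite (RintegralD mO i1 i2).
  under eq_Rintegral do rewrite mulrBl.
  under [X in _ = _ + X]eq_Rintegral do rewrite mulrBl.
  rewrite (RintegralB mO j1 j2) (RintegralB mO j3 j4).
  by rewrite (test_parts i tf tp) -/a -/b opprK addrACA subrr addr0.
have i3 := intgD mO i1 i2.
apply: le_trans (le_normr_Rintegral mO i3) _.
have iC : intg (fun x => partial i psi x ^+ 2 + psi x ^+ 2).
  by apply: intgD => //; [case: (sdp i)|case: sp].
have ih := h1_dist_intg s (test_sqpair tf).
apply: (@le_trans _ _ (d^-1 * h1_dist f G phi (fun i => partial i phi) + d * C)).
  rewrite /C -RintegralD//; [|by case: (sdp i)|by case: sp].
  rewrite -!RintegralZl// -RintegralD//; [|exact: intgZ..].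
  apply: le_Rintegral => //.
  + exact: integrable_norm.
  + by apply: intgD => //; exact: intgZ.
  move=> x _; set u := f x - _; set v := G i x - _.
  set p := partial i psi x; set q := psi x.
  have : u ^+ 2 + v ^+ 2 <= u ^+ 2 + \sum_(j < n.+1) (G j x - partial j phi x) ^+ 2.
    rewrite lerD2l (bigD1 i)//= lerDl; apply: sumr_ge0 => j _; exact: sqr_ge0.
  move=> le1; apply: (@le_trans _ _ (d^-1 * (u ^+ 2 + v ^+ 2) + d * (p ^+ 2 + q ^+ 2))).
    apply: le_trans (ler_normD _ _) _.
    have := young_weighted u p d0; have := young_weighted v q d0.
    by rewrite !mulrDr; move: (d^-1 * _) (d^-1 * _) (d * _) (d * _) => *; lra.
  by rewrite lerD2r ler_wpM2l// invr_ge0 ltW.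
move: (h1_dist _ _ _ _) hd => A hA; clear a b; clearbody C.
rewrite mulrDr lerD2r -ler_pdivlMl ?invr_gt0// invrK.
by rewrite (le_trans (ltW hA))// mulrA -expr2 ler_peMr ?sqr_ge0// ler1n.
Qed.

Definition dx (u : H10 Omega) : 'I_n.+1 -> Rn R n -> R := fun i x => grad u x 0 i.

Lemma H10_sqpair (u : H10 Omega) : sqpair (u : V -> R) (dx u).
Proof. by split=> [|i]; [exact: H10_L2|exact: (H10_grad_L2 u)]. Qed.

Lemma H10_adherent (u : H10 Omega) : adherent (u : V -> R) (dx u).
Proof.
move=> e e0; have [phi tp h] := H10_closure u e0; exists phi => //.
by move: h; rewrite /H1_sqdist EInt ?lte_fin//;
  apply: (h1_dist_intg (H10_sqpair u) (test_sqpair tp)).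
Qed.

(** The weak gradient identity is a consequence of the approximation property. *)
Lemma mkH10 f G : sqpair f G -> adherent f G ->
  exists u : H10 Omega, (u : V -> R) = f /\ dx u = G.
Proof.
move=> s a; pose g : V -> V := fun x => \row_i G i x.
have gE i : (fun x => g x 0 i) = G i by apply/funext => x; rewrite mxE.
have sg i : L2 Omega (fun x => g x 0 i) by rewrite gE; exact: (s.2 i).
have wg : weak_gradient Omega f g.
  move=> psi tp i; have [sp sdp] := test_sqpair tp.
  rewrite EInt; last by apply: intgM => //; case: s.
  rewrite (adherent_parts s a)//.
  under [in RHS]eq_integral do rewrite mxE.
  by rewrite EInt//; apply: intgM => //; case: s.
have cg e : 0 < e -> exists2 phi, test phi & (H1_sqdist Omega f g phi < e%:E)%E.
  move=> e0; have [phi tp h] := a _ e0; exists phi => //.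
  rewrite /H1_sqdist; under eq_integral do under eq_bigr do rewrite mxE.
  by rewrite EInt ?lte_fin//; exact: h1_dist_intg s (test_sqpair tp).
exists (MkH10 s.1 sg wg cg); split=> //.
by apply/funext => i; rewrite /dx /= gE.
Qed.

Lemma adherent_closed f G : sqpair f G ->
  (forall e : R, 0 < e -> exists f' G',
     [/\ sqpair f' G', adherent f' G' & h1_dist f G f' G' < e]) -> adherent f G.
Proof.
move=> s a e e0; have e4 : 0 < e / 4 by rewrite divr_gt0.
have [f' [G' [s' /(_ _ e4)[phi tp h2] h1]]] := a _ e4.
exists phi => //; apply: le_lt_trans (h1_dist_triangle s s' (test_sqpair tp)) _; lra.
Qed.

Lemma sqpair_lin f G f' G' c : sqpair f G -> sqpair f' G' ->
  sqpair (fun x => f x + c * f' x) (fun i x => G i x + c * G' i x).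
Proof.
move=> [sf sG] [sf' sG']; split=> [|i].
  exact: (sqintD mO sf (sqintZ mO c sf')).
exact: (sqintD mO (sG i) (sqintZ mO c (sG' i))).
Qed.

Lemma adherent_lin f G f' G' c : sqpair f G -> sqpair f' G' ->
  adherent f G -> adherent f' G' ->
  adherent (fun x => f x + c * f' x) (fun i x => G i x + c * G' i x).
Proof.
move=> s s' a a' e e0; pose k := 4 * (1 + c ^+ 2).
have k0 : 0 < k by rewrite mulr_gt0// ltr_wpDr ?sqr_ge0.
have ek : 0 < e / k by rewrite divr_gt0.
have [phi tp h] := a _ ek; have [psi tq h'] := a' _ ek.
exists (fun x => phi x + c * psi x); first exact: test_lin.
have ih := h1_dist_intg s (test_sqpair tp); have ih' := h1_dist_intg s' (test_sqpair tq).
apply: (@le_lt_trans _ _ (2 * h1_dist f G phi (fun i => partial i phi) +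
   (2 * c ^+ 2) * h1_dist f' G' psi (fun i => partial i psi))); last first.
  move: (h1_dist _ _ _ _) (h1_dist _ _ _ _) h h' => A B hA hB.
  have kE : k * (e / k) = e by rewrite mulrC divfK// gt_eqF.
  by move: ek kE hA hB (sqr_ge0 c); rewrite /k; set t := e / _; nra.
rewrite -(RintegralZl 2 mO ih) -(RintegralZl (2 * c ^+ 2) mO ih').
have jh := intgZ mO 2 ih; have jh' := intgZ mO (2 * c ^+ 2) ih'.
rewrite -(RintegralD mO jh jh').
have st := test_sqpair (test_lin c tp tq).
apply: (le_Rintegral mO (h1_dist_intg (sqpair_lin c s s') st) (intgD mO jh jh')).
have sqle (a1 a2 b1 b2 : R) : (a1 + c * b1 - (a2 + c * b2)) ^+ 2 <=
    2 * (a1 - a2) ^+ 2 + 2 * c ^+ 2 * (b1 - b2) ^+ 2.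
  rewrite -subr_ge0 (_ : _ - _ = ((a1 - a2) - c * (b1 - b2)) ^+ 2) ?sqr_ge0//; ring.
move=> x _; rewrite !mulrDr addrACA; apply: lerD; first exact: sqle.
rewrite !mulr_sumr -big_split/=; apply: ler_sum => i _.
by rewrite partial_lin//; exact: sqle.
Qed.

End sobolev_tools.

(** * The lattice structure of H^1_0 *)

Section smoothabs_bounds.
Variable R : realType.
Implicit Types e s a b : R.

Lemma smoothabs_sqr e s : smoothabs e s ^+ 2 = s ^+ 2 + e ^+ 2.
Proof. by rewrite sqr_sqrtr// addr_ge0 ?sqr_ge0. Qed.

Lemma smoothabs_ge e s : `|s| <= smoothabs e s.
Proof. by rewrite -sqrtr_sqr ler_sqrt ?addr_ge0 ?sqr_ge0// lerDl sqr_ge0. Qed.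

Lemma smoothabs_le e s : 0 < e -> smoothabs e s <= `|s| + e.
Proof.
move=> e0; have s0 := normr_ge0 s.
have -> : `|s| + e = Num.sqrt ((`|s| + e) ^+ 2).
  by rewrite sqrtr_sqr (ger0_norm (_ : 0 <= `|s| + e))// addr_ge0// ltW.
rewrite ler_sqrt ?sqr_ge0// sqrrD real_normK ?num_real//.
by rewrite addrAC lerDl mulrn_wge0// mulr_ge0// ltW.
Qed.

Lemma smoothabs_lipschitz e a b : 0 < e ->
  (smoothabs e a - smoothabs e b) ^+ 2 <= (a - b) ^+ 2.
Proof.
move=> e0; have wa := smoothabs_gt0 a e0; have wb := smoothabs_gt0 b e0.
have ha := smoothabs_sqr e a; have hb := smoothabs_sqr e b.
move: (smoothabs e a) (smoothabs e b) wa wb ha hb => A B A0 B0 hA hB.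
suff : a * b + e ^+ 2 <= A * B by move: hA hB; nra.
have [//|h] := leP (a * b + e ^+ 2) (A * B).
have : (A * B) ^+ 2 < (a * b + e ^+ 2) ^+ 2.
  by rewrite ltrXn2r// ?nnegrE ?mulr_ge0 ?ltW// (lt_trans _ h)// mulr_gt0.
rewrite exprMn hA hB => lt.
have : 0 <= e ^+ 2 * (a - b) ^+ 2 by rewrite mulr_ge0 ?sqr_ge0.
by move: lt; rewrite ltNge => /negP lt h2; exfalso; apply: lt; nra.
Qed.

Lemma smoothsgn_le1 e s : 0 < e -> `|s / smoothabs e s| <= 1.
Proof.
move=> e0; have w0 := smoothabs_gt0 s e0.
by rewrite normrM normfV (gtr0_norm w0) ler_pdivrMr// mul1r smoothabs_ge.
Qed.

Lemma smoothsgn_cvg s :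
  (fun k : nat => s / smoothabs k.+1%:R^-1 s) @ \oo --> Num.sg s.
Proof.
have [->|s0] := eqVneq s 0.
  by rewrite sgr0; under eq_fun do rewrite mul0r; exact: cvg_cst.
have ns : 0 < `|s| by rewrite normr_gt0.
have c0 : (fun k : nat => k.+1%:R^-1 / `|s| : R) @ \oo --> (0 : R).
  by rewrite -[X in _ --> X](mul0r (`|s|^-1)); apply: cvgMl; exact: cvg_harmonic.
apply/cvgrPdist_le => d d0.
move/cvgrPdist_le : c0 => /(_ _ d0); apply: filterS => k; rewrite sub0r normrN.
apply: le_trans; rewrite [leRHS]ger0_norm ?divr_ge0//.
have e0 : 0 < k.+1%:R^-1 :> R by rewrite invr_gt0.
set e := _^-1 in e0 *; have w0 := smoothabs_gt0 s e0.
have -> : s / smoothabs e s = Num.sg s * (`|s| / smoothabs e s) by rewrite mulrA -numEsg.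
rewrite -{1}[Num.sg s]mulr1 -mulrBr normrM normr_sg s0 mul1r.
rewrite ler_pdivlMr//.
have h1 := smoothabs_ge e s; have h2 := smoothabs_le s e0.
move: (smoothabs e s) w0 h1 h2 => w w0 h1 h2.
have -> : 1 - `|s| / w = (w - `|s|) / w by field; rewrite gt_eqF.
have wn : 0 <= (w - `|s|) / w by rewrite divr_ge0 ?subr_ge0// ltW.
rewrite (ger0_norm wn) -mulrA.
rewrite (@le_trans _ _ (w - `|s|))//; last by lra.
by rewrite ler_piMr ?subr_ge0// mulrC ler_pdivrMr// mul1r.
Qed.

Lemma measurable_smoothsgn e : 0 < e ->
  measurable_fun setT (fun s => s / smoothabs e s).
Proof.
move=> e0; apply: measurable_funM => //; apply: continuous_measurable_fun.
apply: cont_real_derivable => s.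
have := is_derive_inv _ (is_derive_smoothabs s e0).
by rewrite gt_eqF ?smoothabs_gt0// => /(_ isT) [].
Qed.

Lemma measurable_sgr : measurable_fun setT (@Num.sg R).
Proof.
apply: (measurable_fun_cvg (h := fun k s => s / smoothabs k.+1%:R^-1 s)).
  by move=> k; apply: measurable_smoothsgn; rewrite invr_gt0.
by move=> s _; exact: smoothsgn_cvg.
Qed.

End smoothabs_bounds.

Section sobolev_lattice.
Context {R : realType} {n : nat}.
Local Notation V := 'rV[R]_n.+1.
Local Notation mu := (lebesgue R n).
Variable Omega : set V.
Hypothesis oO : open Omega.
Hypothesis bO : bounded_set Omega.
Local Notation Int f := (\int[mu]_(x in Omega) f x)%R.
Local Notation intg f := (mu.-integrable Omega (EFin \o f)).
Local Notation sq f := (sqint mu Omega f).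
Local Notation test := (test_function Omega).
Local Notation sqpair := (@sqpair R n Omega).
Local Notation adherent := (@adherent R n Omega).
Local Notation h1_dist := (@h1_dist R n Omega).
Implicit Types (f phi psi : Rn R n -> R) (G : 'I_n.+1 -> Rn R n -> R).

Local Notation mfun f := (measurable_fun (Omega : set (Rn R n)) (f : Rn R n -> R)).

Let mO : measurable (Omega : set (Rn R n)). Proof. exact: open_measurable_Rn. Qed.
Let fO : (mu Omega < +oo)%E. Proof. exact: lebesgue_bounded_lty. Qed.

Definition grad_sqr G (x : Rn R n) : R := \sum_(i < n.+1) G i x ^+ 2.

Lemma grad_sqr_ge0 G x : 0 <= grad_sqr G x.
Proof. by apply: sumr_ge0 => i _; rewrite sqr_ge0. Qed.

Lemma grad_sqr_intg f G : sqpair f G -> intg (grad_sqr G).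
Proof. by move=> s; apply: intg_sum => // i; case: (s.2 i). Qed.

Lemma adherent_seq f G : adherent f G -> exists phi : nat -> Rn R n -> R,
  (forall k, test (phi k)) /\
  forall k, h1_dist f G (phi k) (fun i => partial i (phi k)) < 4^-1 ^+ k.
Proof.
move=> a; have h k : exists phi, test phi /\
    h1_dist f G phi (fun i => partial i phi) < 4^-1 ^+ k.
  by have [|phi tp hp] := a (4^-1 ^+ k); [rewrite exprn_gt0// invr_gt0|exists phi].
have [phi hphi] := choice h; exists phi; split=> k; by case: (hphi k).
Qed.

Lemma cvg_4V : (fun k => 4^-1 ^+ k : R) @ \oo --> (0 : R).
Proof. by apply: cvg_expr; rewrite ger0_norm ?invr_ge0// invf_lt1// ltr1n. Qed.

Lemma smoothsgn_sqpair e f G : 0 < e -> sqpair f G ->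
  sqpair (fun x => smoothabs e (f x) - e) (fun i x => f x / smoothabs e (f x) * G i x).
Proof.
move=> e0 [[mf jf] sG]; split.
  apply: (sqint_le mO _ _ (conj mf jf)).
    apply: (measurable_comp1 (F := fun s => smoothabs e s - e) _ mf).
    apply: measurable_funB => //.
    apply: continuous_measurable_fun; apply: cont_real_derivable => s.
    by have [] := is_derive_smoothabs s e0.
  move=> x _; have := smoothabs_le (f x) e0; have := smoothabs_ge e (f x).
  move=> h1 h2; have h3 : e <= smoothabs e (f x).
    rewrite -[X in X <= _]gtr0_norm// -sqrtr_sqr /smoothabs ler_sqrt ?addr_ge0 ?sqr_ge0//.
    by rewrite lerDr sqr_ge0.
  by rewrite ger0_norm ?subr_ge0// lerBlDr.
move=> i; apply: (sqintM_bounded mO (h := fun x => f x / smoothabs e (f x)) (M := 1) _ _ (sG i)).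
  exact: (measurable_comp1 (measurable_smoothsgn e0) mf).
by move=> x _; exact: smoothsgn_le1.
Qed.

(** If phi_k -> f in H^1 fast enough to converge almost everywhere, then
    sqrt (phi_k^2 + e^2) - e are test functions, and their gradients
    r (phi_k) grad phi_k, with r (s) = s / sqrt (s^2 + e^2) bounded by 1, differ from
    r (f) grad f by r (phi_k) (grad phi_k - grad f) and (r (phi_k) - r (f)) grad f.
    The second term tends to 0 by dominated convergence. *)
Lemma adherent_smoothabs e f G : 0 < e -> sqpair f G -> adherent f G ->
  adherent (fun x => smoothabs e (f x) - e) (fun i x => f x / smoothabs e (f x) * G i x).
Proof.
move=> e0 s a; have [phi [tphi hphi]] := adherent_seq a.
have st k := test_sqpair oO bO (tphi k).
have mf : mfun f := s.1.1.
have mp k : mfun (phi k) := (st k).1.1.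
pose r t := t / smoothabs e t.
have mr : measurable_fun setT r by exact: measurable_smoothsgn.
have r1 t : `|r t| <= 1 by exact: smoothsgn_le1.
have phif : {ae mu, forall x, Omega x -> (fun k => phi k x) @ \oo --> f x}.
  apply: (ae_cvg_fast mO (fun k => (st k).1) s.1) => k.
  apply: (@le_trans _ _ (h1_dist f G (phi k) (fun i => partial i (phi k)))); last exact/ltW.
  apply: le_trans (h1_dist_fun oO s (st k)).
  under eq_Rintegral do rewrite -sqrrN opprB.
  by [].
have cr : continuous r.
  move=> t; apply: cvgM; first exact: cvg_id.
  have := is_derive_inv _ (is_derive_smoothabs t e0).
  rewrite gt_eqF ?smoothabs_gt0// => /(_ isT) [+ _].
  by move=> /derivable1_diffP/differentiable_continuous.
have mt k : mfun (fun x => r (f x) - r (phi k x)).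
  exact: (measurable_funB (measurable_comp1 mr mf) (measurable_comp1 mr (mp k))).
have t2 k x : `|r (f x) - r (phi k x)| <= 2.
  by rewrite (le_trans (ler_normB _ _))// (natrD _ 1 1) lerD.
have c0 := @Int_sqrM_cvg0 _ _ _ mu Omega mO (fun k x => r (f x) - r (phi k x)) (grad_sqr G).
have {}c0 : (fun k => Int (fun x => (r (f x) - r (phi k x)) ^+ 2 * grad_sqr G x)) @ \oo --> (0 : R).
  apply: c0.
  - exact: mt.
  - exact: t2.
  - apply: ae_in_imply phif => x _ px.
    rewrite -[X in _ --> X](subrr (r (f x))); apply: cvgB; first exact: cvg_cst.
    exact: (cvg_comp _ _ px (cr _)).
  - exact: grad_sqr_intg s.
  - exact: grad_sqr_ge0.
have c1 : (fun k => 2 * Int (fun x => (r (f x) - r (phi k x)) ^+ 2 * grad_sqr G x) + 2 * 4^-1 ^+ k)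
    @ \oo --> (0 : R).
  rewrite -[X in _ --> X](addr0 0) -{1}[X in _ --> X + _](mulr0 2) -[X in _ --> _ + X](mulr0 2).
  by apply: cvgD; apply: cvgMr; [exact: c0|exact: cvg_4V].
move=> d d0; move/cvgrPdist_lt : c1 => /(_ _ d0) [K _ /(_ _ (leqnn K))] /=.
rewrite sub0r normrN => hK.
have [tt dt] := test_smoothabs e0 (tphi K).
exists (fun x => smoothabs e (phi K x) - e) => //.
apply: le_lt_trans hK; apply: le_trans (ler_norm _).
have ih := h1_dist_intg oO s (st K).
have ig : intg (fun x => (r (f x) - r (phi K x)) ^+ 2 * grad_sqr G x).
  exact: (intg_sqrM mO (mt K) (t2 K) (grad_sqr_intg s) (grad_sqr_ge0 G)).
apply: (@le_trans _ _ (2 * Int (fun x => (r (f x) - r (phi K x)) ^+ 2 * grad_sqr G x) +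
    2 * h1_dist f G (phi K) (fun i => partial i (phi K)))); last first.
  by rewrite lerD2l ler_wpM2l// ltW.
rewrite -(RintegralZl 2 mO ig) -(RintegralZl 2 mO ih).
have ig2 := intgZ mO 2 ig; have ih2 := intgZ mO 2 ih.
rewrite -(RintegralD mO ig2 ih2).
have ss := smoothsgn_sqpair e0 s.
apply: (le_Rintegral mO (h1_dist_intg oO ss (test_sqpair oO bO tt)) (intgD mO ig2 ih2)).
move=> x _; rewrite mulrDr addrCA; apply: lerD.
  rewrite opprB addrA subrK; apply: le_trans (smoothabs_lipschitz _ _ e0) _.
  by rewrite ler_peMl ?sqr_ge0// ler1n.
rewrite /grad_sqr mulr_sumr !mulr_sumr -big_split/=; apply: ler_sum => i _.
rewrite dt -/(r (f x)) -/(r (phi K x)).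
have := r1 (phi K x); move: (r (f x)) (r (phi K x)) (G i x) (partial i (phi K) x) => p q y z q1.
have q2 : q ^+ 2 <= 1 by move: q1; rewrite ler_norml => /andP[? ?]; nra.
have := mulr_ge0 (_ : 0 <= 1 - q ^+ 2) (sqr_ge0 (y - z)); rewrite subr_ge0 => /(_ q2) h.
by have := sqr_ge0 ((p - q) * y - q * (y - z)); nra.
Qed.

(** Let e tend to 0 in the preceding lemma.  As s / sqrt (s^2 + e^2) is odd in s,
    the limit sgn (u) grad u is reached pointwise also where u = 0. *)
Lemma H10_abs (u : H10 Omega) : exists w : H10 Omega,
  (w : V -> R) = (fun x => `|u x|) /\ dx w = (fun i x => Num.sg (u x) * dx u i x).
Proof.
have s := H10_sqpair u; have a := H10_adherent oO bO u.
have mu' : mfun u := s.1.1.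
have mr (e : R) (e0 : 0 < e) := @measurable_smoothsgn R e e0.
have ms := @measurable_sgr R.
have sg1 (t : R) : `|Num.sg t| <= 1 by rewrite normr_sg; case: (t != 0) => //=.
have sa : sqpair (fun x => `|u x|) (fun i x => Num.sg (u x) * dx u i x).
  split.
    apply: (sqint_le mO _ _ s.1); first exact: (measurable_comp1 (@normr_measurable R setT) mu').
    by move=> x _; rewrite normr_id.
  move=> i; apply: (sqintM_bounded mO (h := fun x => Num.sg (u x)) (M := 1) _ _ (s.2 i)).
    exact: (measurable_comp1 ms mu').
  by move=> x _; exact: sg1.
apply: mkH10 => //; apply: adherent_closed => // d d0.
pose e (k : nat) := k.+1%:R^-1 : R.
have e0 k : 0 < e k by rewrite invr_gt0.
have mt k : mfun (fun x => Num.sg (u x) - u x / smoothabs (e k) (u x)).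
  exact: (measurable_funB (measurable_comp1 ms mu') (measurable_comp1 (mr _ (e0 k)) mu')).
have t2 k x : `|Num.sg (u x) - u x / smoothabs (e k) (u x)| <= 2.
  rewrite (le_trans (ler_normB _ _))// (natrD _ 1 1) lerD//; exact: smoothsgn_le1.
have c0 : (fun k => Int (fun x => (Num.sg (u x) - u x / smoothabs (e k) (u x)) ^+ 2 *
    grad_sqr (dx u) x)) @ \oo --> (0 : R).
  apply: (@Int_sqrM_cvg0 _ _ _ mu Omega mO
    (fun k x => Num.sg (u x) - u x / smoothabs (e k) (u x)) (grad_sqr (dx u))).
  - exact: mt.
  - exact: t2.
  - apply: ae_in_all => x _; rewrite -[X in _ --> X](subrr (Num.sg (u x))).
    by apply: cvgB; [exact: cvg_cst|exact: smoothsgn_cvg].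
  - exact: grad_sqr_intg s.
  - exact: grad_sqr_ge0.
have c1 : (fun k => fine (mu Omega) * (e k * e k) + Int (fun x => (Num.sg (u x) - u x / smoothabs (e k) (u x)) ^+ 2 *
    grad_sqr (dx u) x)) @ \oo --> (0 : R).
  rewrite -[X in _ --> X](addr0 0) -{1}[X in _ --> X + _](mulr0 (fine (mu Omega))) -{1}(mulr0 0).
  by apply: cvgD => //; apply: cvgMr; apply: cvgM; exact: cvg_harmonic.
move/cvgrPdist_lt : c1 => /(_ _ d0) [K _ /(_ _ (leqnn K))] /=.
rewrite sub0r normrN => hK.
exists (fun x => smoothabs (e K) (u x) - e K).
exists (fun i x => u x / smoothabs (e K) (u x) * dx u i x); split.
- exact: smoothsgn_sqpair.
- exact: adherent_smoothabs.
apply: le_lt_trans hK; apply: le_trans (ler_norm _).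
have ig : intg (fun x => (Num.sg (u x) - u x / smoothabs (e K) (u x)) ^+ 2 * grad_sqr (dx u) x).
  exact: (intg_sqrM mO (mt K) (t2 K) (grad_sqr_intg s) (grad_sqr_ge0 _)).
have ic : intg (fun=> e K * e K) by exact: (intg_cst mO fO).
rewrite mulrC -(Rintegral_cst mu mO (e K * e K)) -(RintegralD mO ic ig).
have ss := smoothsgn_sqpair (e0 K) s.
apply: (le_Rintegral mO (h1_dist_intg oO sa ss) (intgD mO ic ig)).
move=> x _; apply: lerD.
  have h1 := smoothabs_ge (e K) (u x); have h2 := smoothabs_le (u x) (e0 K).
  by move: (smoothabs _ _) `|u x| h1 h2 (e0 K) => w t h1 h2 h3; nra.
by rewrite /grad_sqr mulr_sumr; apply: ler_sum => i _; rewrite -mulrBl exprMn.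
Qed.

End sobolev_lattice.

(** * Poincare inequality and completeness *)

Lemma poincare_bound (R : realFieldType) (C d t H I1 I2 I3 I4 I5 I6 D : R) :
  0 <= C -> (2 + 4 * C) * t = d -> H <= t -> I1 <= H -> I2 <= H ->
  I3 <= C * I4 -> I5 <= 2 * I1 + 2 * I3 -> I4 <= 2 * I2 + 2 * I6 -> I6 <= D ->
  I5 <= 4 * C * D + d.
Proof.
move=> C0 <- Ht I1H I2H I34 I5le I4le I6D.
have := ler_wpM2l C0 I4le; have := ler_wpM2l C0 I6D; have := ler_wpM2l C0 I2H.
have := ler_wpM2l C0 Ht; lra.
Qed.

Lemma cvgD0 (R : realType) (a b c : nat -> R) :
  a @ \oo --> (0 : R) -> b @ \oo --> (0 : R) -> (forall k, c k = a k + b k) ->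
  c @ \oo --> (0 : R).
Proof.
by move=> a0 b0 /funext ->; rewrite -[X in _ --> X](addr0 0); exact: cvgD.
Qed.

Lemma cvg_sum0 (R : realType) (I : Type) (r : seq I) (F : I -> nat -> R) :
  (forall i, F i @ \oo --> (0 : R)) ->
  (fun k => \sum_(i <- r) F i k) @ \oo --> (0 : R).
Proof.
move=> F0; elim: r => [|i r IH].
  by under eq_fun do rewrite big_nil; exact: cvg_cst.
by apply: (cvgD0 (F0 i) IH) => k; rewrite big_cons.
Qed.

Section poincare.
Context {R : realType} {n : nat}.
Local Notation V := 'rV[R]_n.+1.
Local Notation mu := (lebesgue R n).
Variable Omega : set V.
Hypothesis oO : open Omega.
Hypothesis bO : bounded_set Omega.
Local Notation Int f := (\int[mu]_(x in Omega) f x)%R.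
Local Notation intg f := (mu.-integrable Omega (EFin \o f)).
Local Notation sq f := (sqint mu Omega f).
Local Notation test := (test_function Omega).
Local Notation sqpair := (@sqpair R n Omega).
Local Notation adherent := (@adherent R n Omega).
Local Notation h1_dist := (@h1_dist R n Omega).
Implicit Types (f phi psi : Rn R n -> R) (G : 'I_n.+1 -> Rn R n -> R).
Local Notation mfun f := (measurable_fun (Omega : set (Rn R n)) (f : Rn R n -> R)).

Let mO : measurable (Omega : set (Rn R n)). Proof. exact: open_measurable_Rn. Qed.

Lemma H10_lin (u v : H10 Omega) c : exists w : H10 Omega,
  (w : V -> R) = (fun x => u x + c * v x) /\ dx w = (fun i x => dx u i x + c * dx v i x).
Proof.
have su := H10_sqpair u; have sv := H10_sqpair v.
apply: (mkH10 oO bO); first exact: sqpair_lin.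
exact: (adherent_lin oO bO c su sv (H10_adherent oO bO u) (H10_adherent oO bO v)).
Qed.

(** On the set where u = 0 this gradient is half of grad u instead of 0;
    the comparison argument uses the bounds 0 <= (1 + sgn u) / 2 <= 1. *)
Lemma H10_pos (u : H10 Omega) : exists w : H10 Omega,
  (w : V -> R) = (fun x => Num.max (u x) 0) /\
  dx w = (fun i x => (1 + Num.sg (u x)) / 2 * dx u i x).
Proof.
have [a [aE daE]] := H10_abs oO bO u.
have [b [bE dbE]] := H10_lin u a 1.
have [w [wE dwE]] := H10_lin b b (- 2^-1).
exists w; split.
  rewrite wE bE aE; apply/funext => x; rewrite maxr_absE subr0 addr0; by field.
by rewrite dwE dbE daE; apply/funext => i; apply/funext => x; field.
Qed.

Lemma coord_is_derive (i : 'I_n.+1) (x : V) :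
  is_derive x (delta_mx 0 i) (fun y : V => y 0 i) 1.
Proof.
have h : (fun k : R => k^-1 *: (((fun y : V => y 0 i) \o shift x) (k *: delta_mx 0 i) - x 0 i))
    @ 0^' --> (1 : R).
  have : (fun _ : R => 1 : R) @ 0^' --> (1 : R) by exact: cvg_cst.
  apply: cvg_trans; apply: near_eq_cvg; near=> k.
  rewrite /shift/= !mxE !eqxx mulr1 addrK /GRing.scale/= mulVf//.
  near: k; exact: nbhs_dnbhs_neq.
split; first by apply/cvg_ex; exists 1.
exact: cvg_lim h.
Unshelve. all: by end_near. Qed.

(** The derivative of x_0 phi^2 has integral 0, so that
    int phi^2 = - int 2 x_0 phi d_0 phi
              <= (1 / 2) int phi^2 + 2 K^2 int |d_0 phi|^2
    when |x_0| <= K on Omega. *)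
Lemma poincare_test : exists2 C : R, 0 <= C & forall phi, test phi ->
  Int (fun x => phi x ^+ 2) <= C * Int (fun x => partial ord0 phi x ^+ 2).
Proof.
have [M [_ /(_ (`|M| + 1))]] := bO.
rewrite (le_lt_trans (ler_norm _)) ?ltrDl// => /(_ isT).
set K := `|M| + 1 => OK.
have K0 : 0 <= K by rewrite addr_ge0.
have cK x : Omega x -> `|x 0 ord0| <= K.
  move=> /OK; apply: le_trans; rewrite [leRHS]/Num.norm /= mx_normrE.
  by apply/bigmax_geP; right; exists (0, ord0).
exists (4 * K ^+ 2); first by rewrite mulr_ge0 ?sqr_ge0.
move=> phi tp; have [cp dp cdp] := test_C1 tp; have [_ cS SO] := tp.
have [sp sdp] := test_sqpair oO bO tp.
pose c (x : V) := x 0 ord0.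
have cc : continuous c by exact: coord_continuous.
have dc (x : V) := @coord_is_derive ord0 x.
pose psi (x : V) := c x * (phi x * phi x).
have dpp x : derivable (fun x : V => phi x * phi x) x (delta_mx 0 ord0).
  exact: (derivableM (dp ord0 x) (dp ord0 x)).
have dcx x : derivable c x (delta_mx 0 ord0) by case: (dc x).
have E : partial ord0 psi = (fun x => phi x ^+ 2 + 2 * (c x * phi x * partial ord0 phi x)).
  apply/funext => x; apply: etrans (deriveM (dcx x) (dpp x)) _.
  have -> : 'D_(delta_mx 0 ord0) c x = 1 by case: (dc x).
  rewrite (deriveM (dp ord0 x) (dp ord0 x)) /GRing.scale/= -/(partial ord0 phi x).
  by move: (partial _ _ _) => d; ring.
have scp : sq (fun x => c x * phi x).
  apply: (sqintM_bounded mO (h := c) (M := K) _ cK sp).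
  exact: continuous_measurable_Rn.
have i1 : intg (fun x => phi x ^+ 2) := sp.2.
have i2 := intgZ mO 2 (intgM mO scp (sdp ord0)).
have : Int (partial ord0 psi) = 0.
  apply: (Rintegral_partial0 mO cS SO).
  - by move=> y /test_off p0; rewrite /psi p0 !mulr0.
  - by apply: contM => //; exact: contM.
  - by move=> x; exact: (derivableM (dcx x) (dpp x)).
  - rewrite E; apply: contD; first by apply: contM.
    by apply: contM; [exact: cont_cst|apply: contM => //; exact: contM].
rewrite E (RintegralD mO i1 i2) => /eqP; rewrite addr_eq0 => /eqP IE.
have i3 : intg (fun x => partial ord0 phi x ^+ 2) := (sdp ord0).2.
have i4 := intgD mO (intgZ mO 2^-1 i1) (intgZ mO (2 * K ^+ 2) i3).
have : - Int (fun x => 2 * (c x * phi x * partial ord0 phi x)) <=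
    2^-1 * Int (fun x => phi x ^+ 2) + 2 * K ^+ 2 * Int (fun x => partial ord0 phi x ^+ 2).
  rewrite -(RintegralZl _ mO i1) -(RintegralZl _ mO i3).
  rewrite -(RintegralD mO (intgZ mO 2^-1 i1) (intgZ mO (2 * K ^+ 2) i3)).
  rewrite -mulN1r -(RintegralZl _ mO i2).
  apply: (le_Rintegral mO (intgZ mO (-1) i2) i4) => x Ox.
  have := cK _ Ox; rewrite -/(c x).
  move: (c x) (phi x) (partial ord0 phi x) => a p q aK.
  have aK2 : a ^+ 2 <= K ^+ 2 by move: aK; rewrite ler_norml => /andP[? ?]; nra.
  have := sqr_ge0 (p + 2 * a * q).
  by have := ler_wpM2r (sqr_ge0 q) aK2; nra.
have aux (A B : R) : A <= 2^-1 * A + 2 * K ^+ 2 * B -> A <= 4 * K ^+ 2 * B by lra.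
by rewrite -IE; exact: aux.
Qed.

Definition Dir (u v : H10 Omega) : R := Int (fun x => \sum_(i < n.+1) dx u i x * dx v i x).

Lemma Dir_intg (u v : H10 Omega) : intg (fun x => \sum_(i < n.+1) dx u i x * dx v i x).
Proof.
by apply: (intg_sum mO) => i; exact: (intgM mO ((H10_sqpair u).2 i) ((H10_sqpair v).2 i)).
Qed.

Lemma poincare : exists2 C : R, 0 <= C & forall u : H10 Omega,
  Int (fun x => u x ^+ 2) <= C * Dir u u.
Proof.
have [C C0 pC] := poincare_test; exists (4 * C); first by rewrite mulr_ge0.
move=> u; have s := H10_sqpair u.
have le1 : Int (fun x => dx u ord0 x ^+ 2) <= Dir u u.
  apply: (le_Rintegral mO (s.2 ord0).2 (Dir_intg u u)) => x _.
  rewrite (bigD1 ord0)//= -expr2 lerDl; apply: sumr_ge0 => i _.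
  by rewrite -expr2 sqr_ge0.
apply/ler_addgt0Pr => d d0; pose k := 2 + 4 * C.
have k0 : 0 < k by rewrite ltr_wpDr// mulr_ge0.
have [|phi tp hp] := H10_adherent oO bO u (e := d / k); first by rewrite divr_gt0.
have st := test_sqpair oO bO tp.
have h1 := h1_dist_fun oO s st; have h2 := h1_dist_grad oO ord0 s st.
have h3 := pC _ tp.
have sq1 (a b : R) : a ^+ 2 <= 2 * (a - b) ^+ 2 + 2 * b ^+ 2.
  by have := sqr_ge0 (a - 2 * b); nra.
have sq2 (a b : R) : b ^+ 2 <= 2 * (a - b) ^+ 2 + 2 * a ^+ 2.
  by have := sqr_ge0 (2 * a - b); nra.
have t1 : Int (fun x => u x ^+ 2) <= 2 * Int (fun x => (u x - phi x) ^+ 2) +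
    2 * Int (fun x => phi x ^+ 2).
  have j1 : intg (fun x => (u x - phi x) ^+ 2) := (sqintB mO s.1 st.1).2.
  have j2 : intg (fun x => phi x ^+ 2) := st.1.2.
  rewrite -(RintegralZl 2 mO j1) -(RintegralZl 2 mO j2).
  rewrite -(RintegralD mO (intgZ mO 2 j1) (intgZ mO 2 j2)).
  apply: (le_Rintegral mO s.1.2 (intgD mO (intgZ mO 2 j1) (intgZ mO 2 j2))) => x _.
  exact: sq1.
have t2 : Int (fun x => partial ord0 phi x ^+ 2) <=
    2 * Int (fun x => (dx u ord0 x - partial ord0 phi x) ^+ 2) +
    2 * Int (fun x => dx u ord0 x ^+ 2).
  have j1 : intg (fun x => (dx u ord0 x - partial ord0 phi x) ^+ 2) :=
    (sqintB mO (s.2 ord0) (st.2 ord0)).2.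
  have j2 : intg (fun x => dx u ord0 x ^+ 2) := (s.2 ord0).2.
  rewrite -(RintegralZl 2 mO j1) -(RintegralZl 2 mO j2).
  rewrite -(RintegralD mO (intgZ mO 2 j1) (intgZ mO 2 j2)).
  apply: (le_Rintegral mO (st.2 ord0).2 (intgD mO (intgZ mO 2 j1) (intgZ mO 2 j2))) => x _.
  exact: sq2.
have kE : k * (d / k) = d by rewrite mulrC divfK// gt_eqF.
exact: (poincare_bound C0 kE (ltW hp) h1 h2 h3 t1 t2 le1).
Qed.


(** The limits in L^2 of the functions and of their partial derivatives form an
    adherent pair, being approximated by elements of H^1_0. *)
Lemma H10_complete (u : nat -> H10 Omega) :
  (forall k, h1_dist (u k.+1) (dx (u k.+1)) (u k) (dx (u k)) <= 8^-1 ^+ k) ->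
  exists w : H10 Omega,
    (fun k => h1_dist (u k) (dx (u k)) w (dx w)) @ \oo --> (0 : R).
Proof.
move=> uS; have s k := H10_sqpair (u k).
have [f sf cf] := sqint_complete mO (fun k => (s k).1)
  (fun k => le_trans (h1_dist_fun oO (s k.+1) (s k)) (uS k)).
have hG i : exists g : Rn R n -> R, sq g /\
    (fun k => Int (fun x => (dx (u k) i x - g x) ^+ 2)) @ \oo --> (0 : R).
  have [g sg cg] := sqint_complete mO (fun k => (s k).2 i)
    (fun k => le_trans (h1_dist_grad oO i (s k.+1) (s k)) (uS k)).
  by exists g.
have [G hG'] := choice hG.
have sfG : sqpair f G by split=> // i; case: (hG' i).
have cv : (fun k => h1_dist (u k) (dx (u k)) f G) @ \oo --> (0 : R).
  have E k : h1_dist (u k) (dx (u k)) f G = Int (fun x => (u k x - f x) ^+ 2) +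
      \sum_(i < n.+1) Int (fun x => (dx (u k) i x - G i x) ^+ 2).
    have j1 : intg (fun x => (u k x - f x) ^+ 2) := (sqintB mO (s k).1 sf).2.
    have j2 i : intg (fun x => (dx (u k) i x - G i x) ^+ 2) :=
      (sqintB mO ((s k).2 i) (sfG.2 i)).2.
    rewrite /h1_dist (RintegralD mO j1); last exact: (intg_sum mO).
    by congr (_ + _); exact: (Int_sum mO).
  have cG := cvg_sum0 (index_enum 'I_n.+1) (fun i => (hG' i).2).
  exact: cvgD0 cf cG E.
have aw : adherent f G.
  apply: (adherent_closed oO bO sfG) => e e0.
  move/cvgrPdist_lt : cv => /(_ _ e0) [K _ /(_ _ (leqnn K))] /=.
  rewrite sub0r normrN => hK; exists (u K), (dx (u K)); split=> //.
    exact: H10_adherent.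
  apply: le_lt_trans hK; apply: le_trans (ler_norm _).
  apply: (le_Rintegral mO (h1_dist_intg oO sfG (s K)) (h1_dist_intg oO (s K) sfG)) => x _.
  rewrite -[X in X + _ <= _]sqrrN opprB lerD2l; apply: ler_sum => i _.
  by rewrite -[leLHS]sqrrN opprB.
have [w [wE dwE]] := mkH10 oO bO sfG aw.
by exists w; rewrite wE dwE.
Qed.

End poincare.

(** * The clipped power and its primitive *)

Section truncated_power.
Variable R : realType.
Implicit Types A B s t c p al : R.

Definition clip A B s : R := Num.max A (Num.min s B).

Definition clip_powN al A B s : R := clip A B s `^ (- al).

(** A convex function of s, of class C^1 with derivative - clip_powN al A B s:
    it is s^(1 - al) / (al - 1) on [A, B], continued by its tangents at A and B. *)
Definition clip_prim al A B s : R :=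
  clip A B s `^ (1 - al) / (al - 1) - clip_powN al A B s * (s - clip A B s).

Lemma clipP A B s : A <= B ->
  [\/ s <= A /\ clip A B s = A, A <= s <= B /\ clip A B s = s |
      B <= s /\ clip A B s = B].
Proof.
move=> AB; rewrite /clip; have [sB|Bs] := leP s B.
  have [sA|As] := leP s A.
    by apply: Or31; split=> //; apply/max_idPl.
  by apply: Or32; rewrite (ltW As); split=> //; apply/max_idPr; exact: ltW.
by apply: Or33; rewrite ltW//; split=> //; apply/max_idPr.
Qed.

Lemma clip_bounds A B s : A <= B -> A <= clip A B s <= B.
Proof. by move=> AB; case: (clipP s AB) => -[h ->]; rewrite ?lexx ?AB. Qed.

Lemma clip_id A B s : A <= s <= B -> clip A B s = s.
Proof.
move=> /andP[As sB]; rewrite /clip; have /min_idPl -> := sB.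
exact/max_idPr.
Qed.

Lemma powRN_le p s t : 0 <= p -> 0 < s -> s <= t -> t `^ (- p) <= s `^ (- p).
Proof.
move=> p0 s0 st; rewrite !powRN lef_pV2 ?posrE ?powR_gt0//; last exact: lt_le_trans st.
by apply: ge0_ler_powR => //; rewrite nnegrE ltW// (lt_le_trans s0).
Qed.

Lemma clip_powN_ge0 al A B s : 0 <= clip_powN al A B s.
Proof. exact: powR_ge0. Qed.

Lemma clip_powN_le al A B s : 0 <= al -> 0 < A -> A <= B -> clip_powN al A B s <= A `^ (- al).
Proof.
by move=> al0 A0 AB; apply: powRN_le => //; have /andP[] := clip_bounds s AB.
Qed.

Lemma powR_1B al c : 0 < c -> c `^ (1 - al) = c `^ (- al) * c.
Proof.
move=> c0; rewrite addrC powRD; first by rewrite powRr1// ltW.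
by apply/implyP => _; rewrite gt_eqF.
Qed.

(** The convexity of c^(1 - al) / (al - 1).  By homogeneity it is the Bernoulli
    inequality 1 - p (t - 1) <= t^(- p) for p = al - 1 and t = d / c, which follows
    from ln t <= t - 1 and 1 + x <= exp x. *)
Lemma powR_tangent al c d : 1 < al -> 0 < c -> 0 < d ->
  c `^ (1 - al) / (al - 1) - c `^ (- al) * (d - c) <= d `^ (1 - al) / (al - 1).
Proof.
move=> al1 c0 d0; pose p := al - 1; have p0 : 0 < p by rewrite subr_gt0.
pose t := d / c; have t0 : 0 < t by rewrite divr_gt0.
have dE : d = t * c by rewrite /t divfK// gt_eqF.
have key : 1 - p * (t - 1) <= t `^ (- p).
  rewrite /powR gt_eqF//; apply: (@le_trans _ _ (1 + - p * ln t)).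
    rewrite mulNr lerD2l lerN2; apply: (ler_wpM2l (ltW p0)).
    have := @le_ln1Dx R (t - 1); rewrite subrKC; apply.
    by rewrite ltrBrDl addrN.
  exact: expR_ge1Dx.
have c1 := powR_1B al c0.
have d1 : d `^ (1 - al) = t `^ (- p) * (c `^ (- al) * c).
  by rewrite -c1 dE powRM ?ltW// /p opprB.
rewrite d1 c1 -/p {1}dE; set q := c `^ (- al).
have q0 : 0 <= q by exact: powR_ge0.
rewrite -subr_ge0.
have -> : t `^ (- p) * (q * c) / p - (q * c / p - q * (t * c - c)) =
    (q * c / p) * (t `^ (- p) - (1 - p * (t - 1))).
  by field; rewrite gt_eqF.
apply: mulr_ge0; last by rewrite subr_ge0.
by apply: divr_ge0; [exact: mulr_ge0 q0 (ltW c0)|exact: ltW].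
Qed.

(** Compared with the tangent inequality at the clipped points, the extra term is
    (g s - g t) (t - clip t) with g the clipped power.  It is nonnegative because g
    decreases and t is clipped only at the ends A and B, where g is extremal. *)
Lemma clip_prim_tangent al A B s t : 1 < al -> 0 < A -> A <= B ->
  clip_prim al A B s - clip_powN al A B s * (t - s) <= clip_prim al A B t.
Proof.
move=> al1 A0 AB; rewrite /clip_prim /clip_powN.
have /andP[cA cB] := clip_bounds s AB; have /andP[dA dB] := clip_bounds t AB.
have c0 := lt_le_trans A0 cA; have d0 := lt_le_trans A0 dA.
have tg := powR_tangent al1 c0 d0.
have al0 : 0 <= al by rewrite ltW// (lt_trans ltr01).
suff : 0 <= (clip A B s `^ (- al) - clip A B t `^ (- al)) * (t - clip A B t).
  by move: tg; set p := _ / _; set q := _ / _; lra.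
case: (clipP t AB) => -[h E]; rewrite E; last 1 first.
- by apply: mulr_ge0; rewrite subr_ge0//; apply: powRN_le.
- by apply: mulr_le0; rewrite subr_le0//; apply: powRN_le.
- by rewrite subrr mulr0.
Qed.

Lemma clip_prim_bound al A B s : 1 < al -> 0 < A -> A <= B ->
  `|clip_prim al A B s| <= A `^ (- al) * (B / (al - 1) + B) + A `^ (- al) * `|s|.
Proof.
move=> al1 A0 AB; have al0 : 0 <= al by rewrite ltW// (lt_trans ltr01).
have /andP[cA cB] := clip_bounds s AB; have c0 := lt_le_trans A0 cA.
have p0 : 0 < al - 1 by rewrite subr_gt0.
have gle := clip_powN_le s al0 A0 AB; have g0 := clip_powN_ge0 al A B s.
rewrite /clip_prim.
have -> : clip A B s `^ (1 - al) = clip_powN al A B s * clip A B s.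
  exact: powR_1B.
move: (clip_powN al A B s) (A `^ (- al)) (clip A B s) gle g0 cA cB c0 => g M c gM g0 cA cB c0.
have -> : g * c / (al - 1) = g * (c / (al - 1)) by rewrite mulrA.
have h1 : c / (al - 1) <= B / (al - 1) by rewrite ler_pM2r// invr_gt0.
have h0 : 0 <= c / (al - 1) by rewrite divr_ge0// ltW.
move: (c / _) (B / _) h1 h0 => e E eE e0.
rewrite (le_trans (ler_normB _ _))//.
rewrite (ger0_norm (mulr_ge0 g0 e0)) normrM (ger0_norm g0).
have : `|s - c| <= `|s| + B.
  by rewrite (le_trans (ler_normB _ _))// lerD2l ger0_norm// ltW.
have := normr_ge0 (s - c); have := normr_ge0 s.
move: `|s - c| `|s| => y z z0 y0 yz.
rewrite -mulrDr -mulrDr (le_trans (ler_wpM2r _ gM)) ?addr_ge0//.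
by apply: ler_wpM2l; [exact: le_trans gM|lra].
Qed.

Lemma clipE A B s :
  clip A B s = (A + (s + B - `|s - B|) / 2 + `|A - (s + B - `|s - B|) / 2|) / 2.
Proof. by rewrite /clip maxr_absE minr_absE. Qed.

Lemma clip_cvg A B (s_ : nat -> R) s : s_ @ \oo --> s ->
  (fun k => clip A B (s_ k)) @ \oo --> clip A B s.
Proof.
move=> cs; rewrite clipE; under eq_fun do rewrite clipE.
have cm : (fun k => (s_ k + B - `|s_ k - B|) / 2) @ \oo --> (s + B - `|s - B|) / 2.
  apply: cvgMl; apply: cvgB; first by apply: cvgD => //; exact: cvg_cst.
  by apply: cvg_norm; apply: cvgB => //; exact: cvg_cst.
apply: cvgMl; apply: cvgD; first by apply: cvgD => //; exact: cvg_cst.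
by apply: cvg_norm; apply: cvgB => //; exact: cvg_cst.
Qed.

Lemma measurable_clip d (T : measurableType d) (D : set T) (a b f : T -> R) :
  measurable_fun D a -> measurable_fun D b -> measurable_fun D f ->
  measurable_fun D (fun x => clip (a x) (b x) (f x)).
Proof.
move=> ma mb mf; under eq_fun do rewrite clipE.
have mm : measurable_fun D (fun x => (f x + b x - `|f x - b x|) / 2).
  apply: measurable_funM => //; apply: measurable_funB; first exact: measurable_funD.
  by apply: measurableT_comp => //; exact: measurable_funB.
apply: measurable_funM => //; apply: measurable_funD; first exact: measurable_funD.
by apply: measurableT_comp => //; exact: measurable_funB.
Qed.

Lemma clip_powN_cvg al A B (s_ : nat -> R) s : 0 < A -> A <= B -> s_ @ \oo --> s ->
  (fun k => clip_powN al A B (s_ k)) @ \oo --> clip_powN al A B s.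
Proof.
move=> A0 AB cs; have cc := @clip_cvg A B _ _ cs.
have c0 : 0 < clip A B s by have /andP[h _] := clip_bounds s AB; exact: lt_le_trans h.
have [/derivable1_diffP/differentiable_continuous cp _] := is_derive1_powR (- al) c0.
exact: (cvg_comp _ _ cc cp).
Qed.

End truncated_power.

(** * The Dirichlet form *)

Section H10_algebra.
Context {R : realType} {n : nat}.
Local Notation V := 'rV[R]_n.+1.
Local Notation mu := (lebesgue R n).
Variable Omega : set V.
Hypothesis oO : open Omega.
Hypothesis bO : bounded_set Omega.
Local Notation Int f := (\int[mu]_(x in Omega) f x)%R.
Local Notation intg f := (mu.-integrable Omega (EFin \o f)).
Local Notation h1_dist := (@h1_dist R n Omega).
Implicit Types (u v w z : H10 Omega).

Let mO : measurable (Omega : set (Rn R n)). Proof. exact: open_measurable_Rn. Qed.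

Definition hlin u v c : H10 Omega := sval (cid (H10_lin oO bO u v c)).

Lemma hlinE u v c x : hlin u v c x = u x + c * v x.
Proof. by rewrite /hlin; case: cid => w /= [-> _]. Qed.

Lemma dx_hlin u v c i x : dx (hlin u v c) i x = dx u i x + c * dx v i x.
Proof. by rewrite /hlin; case: cid => w /= [_ ->]. Qed.

Definition habs u : H10 Omega := sval (cid (H10_abs oO bO u)).

Lemma habsE u x : habs u x = `|u x|.
Proof. by rewrite /habs; case: cid => w /= [-> _]. Qed.

Lemma dx_habs u i x : dx (habs u) i x = Num.sg (u x) * dx u i x.
Proof. by rewrite /habs; case: cid => w /= [_ ->]. Qed.

Definition hpos u : H10 Omega := sval (cid (H10_pos oO bO u)).

Lemma hposE u x : hpos u x = Num.max (u x) 0.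
Proof. by rewrite /hpos; case: cid => w /= [-> _]. Qed.

Lemma dx_hpos u i x : dx (hpos u) i x = (1 + Num.sg (u x)) / 2 * dx u i x.
Proof. by rewrite /hpos; case: cid => w /= [_ ->]. Qed.

Lemma DirC u v : Dir u v = Dir v u.
Proof. by apply: eq_Rintegral => x _; apply: eq_bigr => i _; rewrite mulrC. Qed.

Lemma Dir_ge0 u : 0 <= Dir u u.
Proof.
by apply: Rintegral_ge0 => x _; apply: sumr_ge0 => i _; rewrite -expr2 sqr_ge0.
Qed.

Lemma Dir_hlin u v c z : Dir (hlin u v c) z = Dir u z + c * Dir v z.
Proof.
have i1 := Dir_intg oO u z; have i2 := Dir_intg oO v z.
rewrite /Dir -(RintegralZl c mO i2) -(RintegralD mO i1 (intgZ mO c i2)).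
apply: eq_Rintegral => x _; rewrite mulr_sumr -big_split/=.
by apply: eq_bigr => i _; rewrite dx_hlin mulrDl mulrA.
Qed.

Lemma Dir_sqr u v c : Dir (hlin u v c) (hlin u v c) =
  Dir u u + 2 * c * Dir u v + c ^+ 2 * Dir v v.
Proof.
rewrite Dir_hlin (DirC u) (DirC v) !Dir_hlin (DirC v u).
by move: (Dir u u) (Dir u v) (Dir v v) => A B C; ring.
Qed.

Lemma Dir_young u v t : 0 < t -> 2 * Dir u v <= t * Dir u u + t^-1 * Dir v v.
Proof.
move=> t0; have := Dir_ge0 (hlin v u (- t)); rewrite Dir_sqr (DirC v u).
move: (Dir u u) (Dir u v) (Dir v v) => A B C h.
have := mulr_ge0 (ltW (_ : 0 < t^-1)) h; rewrite invr_gt0 => /(_ t0).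
have -> : t^-1 * (C + 2 * - t * B + (- t) ^+ 2 * A) = t * A + t^-1 * C - 2 * B.
  by field; rewrite gt_eqF.
by rewrite subr_ge0.
Qed.

Lemma Dir_habs u : Dir (habs u) (habs u) <= Dir u u.
Proof.
apply: (le_Rintegral mO (Dir_intg oO _ _) (Dir_intg oO _ _)) => x _.
apply: ler_sum => i _; rewrite dx_habs -expr2 exprMn -expr2 ler_piMl ?sqr_ge0//.
by rewrite sqr_sg; case: (u x != 0) => //=.
Qed.

(** The factor c = (1 + sgn u) / 2 satisfies c^2 <= c. *)
Lemma Dir_hpos u : Dir (hpos u) (hpos u) <= Dir u (hpos u).
Proof.
apply: (le_Rintegral mO (Dir_intg oO _ _) (Dir_intg oO _ _)) => x _.
apply: ler_sum => i _; rewrite dx_hpos.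
have sg1 : `|Num.sg (u x)| <= 1 by rewrite normr_sg; case: (u x != 0) => //=.
move: sg1; move: (Num.sg (u x)) (dx u i x) => s y; rewrite ler_norml => /andP[h1 h2].
have := mulr_ge0 (mulr_ge0 (_ : 0 <= 1 + s) (_ : 0 <= 1 - s)) (sqr_ge0 y).
rewrite subr_ge0 -(opprK 1) addrC subr_ge0 opprK => /(_ h1 h2); nra.
Qed.

Lemma h1_dist_Dir u v : h1_dist u (dx u) v (dx v) =
  Int (fun x => hlin u v (-1) x ^+ 2) + Dir (hlin u v (-1)) (hlin u v (-1)).
Proof.
have i1 : intg (fun x => hlin u v (-1) x ^+ 2) := (H10_sqpair _).1.2.
rewrite /Dir -(RintegralD mO i1 (Dir_intg oO _ _)).
apply: eq_Rintegral => x _; rewrite hlinE mulN1r; congr (_ + _).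
by apply: eq_bigr => i _; rewrite dx_hlin mulN1r expr2.
Qed.

Lemma Dir_le_h1_dist u v :
  Dir (hlin u v (-1)) (hlin u v (-1)) <= h1_dist u (dx u) v (dx v).
Proof. by rewrite h1_dist_Dir lerDr; apply: Rintegral_ge0 => x _; rewrite sqr_ge0. Qed.

Lemma Dir0_ae0 u : Dir u u <= 0 -> {ae mu, forall x, Omega x -> u x = 0}.
Proof.
move=> D0; have [C C0 pC] := poincare oO bO.
apply: (sqint0_ae0 mO (H10_sqpair u).1).
by apply: le_trans (pC u) _; exact: mulr_ge0_le0.
Qed.

Lemma dirichletE u v : dirichlet u v = (Dir u v)%:E.
Proof. exact: (EInt oO (Dir_intg oO u v)). Qed.

End H10_algebra.

(** * Minimization of the clipped energy *)

Section arithmetic.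
Variable R : realFieldType.
Implicit Types A B C D E I P Q U W k t : R.

Lemma young_arith I D A B C : I <= D -> 2 * D <= A + B -> B <= C -> 2 * I <= A + C.
Proof. lra. Qed.

Lemma energy_lower_arith P I I' D E Q :
  P - I <= Q -> I <= I' -> 2 * I' <= D + E -> P - 2^-1 * D <= 2^-1 * E + Q.
Proof. lra. Qed.

Lemma midpoint_arith P I I' U W A B C : P - I <= U -> P - I' <= W -> I + I' = 0 ->
  2^-1 * (4^-1 * (A + 2 * B + C)) + P + 8^-1 * (A + 2 * -1 * B + (-1) ^+ 2 * C) <=
  2^-1 * (2^-1 * A + U) + 2^-1 * (2^-1 * C + W).
Proof. rewrite sqrrN expr1n; lra. Qed.

Lemma cauchy_arith J D J1 J2 E E1 m : J + 8^-1 * D <= 2^-1 * J1 + 2^-1 * J2 ->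
  m <= J -> J1 <= m + E1 -> J2 <= m + E -> E1 <= E -> D <= 8 * E.
Proof. lra. Qed.

Lemma minimum_arith A B D C P I Q I' t' J k d t : 0 <= k -> 0 <= D -> 0 < d ->
  t * (A + 1 + k * (B + 1)) = d / 2 -> t' <= t ->
  P - I <= Q -> I <= k * I' -> 2 * I' <= t * B + t' ->
  2 * (C + -2 * C) <= t * (A + 2 * -2 * A + (-2) ^+ 2 * A) + t' ->
  2^-1 * (A + 2 * C + D) + Q <= J + d / 2 -> 2^-1 * A + P <= J + d.
Proof.
move=> k0 D0 d0 tE t't h1 h2 h3 h4 h5.
have := ler_wpM2l k0 h3; have := ler_wpM2l k0 t't; move: tE h4; rewrite expr2; nra.
Qed.

Lemma variation_arith t A B C I I' P Q : 0 < t -> P - I' <= Q -> I' = - t * I ->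
  2^-1 * A + Q <= 2^-1 * (A + 2 * t * B + t ^+ 2 * C) + P ->
  I <= B + 2^-1 * t * C.
Proof.
move=> t0 h1 h2 h3; rewrite -(ler_pM2l t0); move: h1 h3; rewrite h2; lra.
Qed.

Lemma opp_arith A I : - I <= A + -2 * A -> A <= I.
Proof. lra. Qed.

End arithmetic.

Section singular_problem.
Context {R : realType} {n : nat}.
Local Notation V := 'rV[R]_n.+1.
Local Notation mu := (lebesgue R n).
Variable Omega : set V.
Hypothesis oO : open Omega.
Hypothesis bO : bounded_set Omega.
Local Notation Int f := (\int[mu]_(x in Omega) f x)%R.
Local Notation intg f := (mu.-integrable Omega (EFin \o f)).
Local Notation h1_dist := (@h1_dist R n Omega).
Local Notation mfun f := (measurable_fun (Omega : set (Rn R n)) (f : Rn R n -> R)).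
Local Notation hlin := (hlin oO bO).
Local Notation habs := (habs oO bO).
Local Notation hpos := (hpos oO bO).
Implicit Types (u v w z : H10 Omega).

Let mO : measurable (Omega : set (Rn R n)). Proof. exact: open_measurable_Rn. Qed.

Variables (al L : R) (a b : H10 Omega).
Hypothesis al1 : 1 < al.
Hypothesis pinch : {ae mu, forall x, Omega x -> [/\ 0 < a x, a x <= b x & b x <= L * a x]}.
Hypothesis suba : subsolution al a.
Hypothesis supb : supersolution al b.

Let al0 : 0 <= al. Proof. by rewrite ltW// (lt_trans ltr01). Qed.

Definition weight (x : Rn R n) : R := b x `^ (- al).

Lemma mfun_H10 u : mfun u. Proof. exact: (H10_sqpair u).1.1. Qed.

Lemma mfun_powN u : mfun (fun x => u x `^ (- al)).
Proof. exact: (measurable_comp1 (measurable_powR (- al)) (mfun_H10 u)). Qed.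

Lemma mfun_norm u : mfun (fun x => `|u x|).
Proof. exact: (measurable_comp1 (@normr_measurable R setT) (mfun_H10 u)). Qed.

(** The supersolution inequality for the test function |v|. *)
Lemma weight_intg_le v :
  intg (fun x => weight x * `|v x|) /\ Int (fun x => weight x * `|v x|) <= Dir b (habs v).
Proof.
have v0 : ae_le Omega (cst 0) (habs v) by apply: ae_in_all => x _; rewrite habsE /= normr_ge0.
have := supb v0; rewrite (dirichletE oO) /singular_term.
have w0 x : Omega x -> (0 <= (b x `^ (- al) * habs v x)%:E)%E.
  by move=> _; rewrite lee_fin habsE mulr_ge0// powR_ge0.
have sE : (\int[mu]_(x in Omega) (b x `^ (- al) * habs v x)%:E =
           \int[mu]_(x in Omega) (weight x * `|v x|)%:E)%E.
  by apply: eq_integral => x _; rewrite habsE.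
have w0' x : Omega x -> (0 <= (weight x * `|v x|)%:E)%E.
  by move=> _; rewrite lee_fin mulr_ge0// powR_ge0.
rewrite sE => h.
have le : (\int[mu]_(x in Omega) (weight x * `|v x|)%:E <= (Dir b (habs v))%:E)%E.
  have : (0 <= \int[mu]_(x in Omega) (weight x * `|v x|)%:E)%E by exact: integral_ge0.
  by move: h; case: (\int[mu]_(x in Omega) _)%E => [r| |]//=; rewrite -?EFinB ?lee_fin ?subr_ge0.
have ig : intg (fun x => weight x * `|v x|).
  apply/integrableP; split.
    apply/measurable_EFinP; exact: (measurable_funM (mfun_powN b) (mfun_norm v)).
  rewrite (_ : (\int[mu]_(x in Omega) _)%E = \int[mu]_(x in Omega) (weight x * `|v x|)%:E)%E.
    exact: le_lt_trans le (ltry _).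
  by apply: eq_integral => x /set_mem Ox; rewrite gee0_abs//; exact: w0'.
split=> //; move: le; rewrite (EInt oO ig) lee_fin; exact.
Qed.

Lemma weight_young v t : 0 < t ->
  2 * Int (fun x => weight x * `|v x|) <= t * Dir b b + t^-1 * Dir v v.
Proof.
move=> t0; have [_ h1] := weight_intg_le v.
have h2 := Dir_young oO bO b (habs v) t0; have h3 := Dir_habs oO bO v.
have h4 : t^-1 * Dir (habs v) (habs v) <= t^-1 * Dir v v.
  by rewrite ler_wpM2l// invr_ge0 ltW.
exact: young_arith h1 h2 h4.
Qed.

Definition pinch_const : R := L `^ al.

Lemma pinch_const_ge0 : 0 <= pinch_const. Proof. exact: powR_ge0. Qed.

Lemma pinch_weight : {ae mu, forall x, Omega x -> a x `^ (- al) <= pinch_const * weight x}.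
Proof.
apply: ae_in_imply pinch => x _ [a0 ab bL].
have b0 := lt_le_trans a0 ab.
have L0 : 0 < L by rewrite -(pmulr_lgt0 _ a0); exact: lt_le_trans bL.
have : (L * a x) `^ (- al) <= weight x by exact: powRN_le.
rewrite (powRM _ (ltW L0) (ltW a0)) (powRN L) -/pinch_const => h.
have K0 : 0 < pinch_const by exact: powR_gt0.
by rewrite -ler_pdivrMl.
Qed.

Definition trunc u (x : Rn R n) : R := clip_powN al (a x) (b x) (u x).

Definition trunc_prim u (x : Rn R n) : R := clip_prim al (a x) (b x) (u x).

Lemma mfun_clip u : mfun (fun x => clip (a x) (b x) (u x)).
Proof. exact: (measurable_clip (mfun_H10 a) (mfun_H10 b) (mfun_H10 u)). Qed.

Lemma mfun_trunc u : mfun (trunc u).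
Proof. exact: (measurable_comp1 (measurable_powR (- al)) (mfun_clip u)). Qed.

Lemma mfun_trunc_prim u : mfun (trunc_prim u).
Proof.
have m1 := measurable_comp1 (measurable_powR (1 - al)) (mfun_clip u).
have m2 := measurable_comp1 (@mulrr_measurable R setT (al - 1)^-1) m1.
exact: (measurable_funB m2 (measurable_funM (mfun_trunc u)
  (measurable_funB (mfun_H10 u) (mfun_clip u)))).
Qed.

Lemma trunc_le u : {ae mu, forall x, Omega x -> trunc u x <= pinch_const * weight x}.
Proof.
apply: ae_in_imply (ae_in_and pinch pinch_weight) => x _ [[a0 ab _]].
exact/le_trans/clip_powN_le.
Qed.

Lemma truncM_le u v : {ae mu, forall x, Omega x -> `|trunc u x * v x| <= pinch_const * (weight x * `|v x|)}.
Proof.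
apply: ae_in_imply (trunc_le u) => x _ h.
by rewrite normrM ger0_norm ?clip_powN_ge0// mulrA ler_wpM2r.
Qed.

Lemma intg_weight v : intg (fun x => pinch_const * (weight x * `|v x|)).
Proof. exact: (intgZ mO pinch_const (weight_intg_le v).1). Qed.

Lemma intg_truncM u v : intg (fun x => trunc u x * v x).
Proof.
exact: (ae_le_intg mO (measurable_funM (mfun_trunc u) (mfun_H10 v)) (truncM_le u v) (intg_weight v)).
Qed.

Lemma intg_trunc_prim u : intg (trunc_prim u).
Proof.
have i1 := intgZ mO ((al - 1)^-1 + 1) (intg_weight b).
apply: (ae_le_intg mO (mfun_trunc_prim u) _ (intgD mO i1 (intg_weight u))).
apply: ae_in_imply (ae_in_and pinch pinch_weight) => x _ [[a0 ab _] aK].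
apply: le_trans (clip_prim_bound (u x) al1 a0 ab) _.
have b0 := lt_le_trans a0 ab; rewrite (gtr0_norm b0).
apply: lerD; last by rewrite mulrA ler_wpM2r.
have -> : b x / (al - 1) + b x = ((al - 1)^-1 + 1) * b x by rewrite mulrDl mul1r mulrC.
rewrite mulrCA; apply: ler_wpM2l; last by rewrite mulrA ler_wpM2r// ltW.
by rewrite addr_ge0// invr_ge0 subr_ge0 ltW.
Qed.

Definition potential u : R := Int (trunc_prim u).

(** Its Euler equation is the weak form of - Laplacian u = trunc u. *)
Definition energy u : R := 2^-1 * Dir u u + potential u.

Lemma potential_tangent u v w : (forall x, w x = v x - u x) ->
  potential u - Int (fun x => trunc u x * w x) <= potential v.
Proof.
move=> wE; rewrite /potential -(RintegralB mO (intg_trunc_prim u) (intg_truncM u w)).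
apply: (ae_le_Int mO (intgB mO (intg_trunc_prim u) (intg_truncM u w)) (intg_trunc_prim v)).
apply: ae_in_imply pinch => x _ [a0 ab _]; rewrite wE.
exact: clip_prim_tangent.
Qed.

Lemma trunc_sup : {ae mu, forall x, Omega x -> trunc b x = weight x}.
Proof.
apply: ae_in_imply pinch => x _ [_ ab _].
by rewrite /trunc /clip_powN clip_id// ab lexx.
Qed.

(** The primitive lies above its tangent at b, whose slope is - weight; the linear
    term is then absorbed by the Dirichlet energy. *)
Lemma energy_ge v : potential b - 2^-1 * Dir b b <= energy v.
Proof.
pose w := hlin v b (-1).
have h1 : potential b - Int (fun x => trunc b x * w x) <= potential v.
  by apply: potential_tangent => x; rewrite hlinE mulN1r.
have h2 : Int (fun x => trunc b x * w x) <= Int (fun x => weight x * `|v x|).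
  apply: (ae_le_Int mO (intg_truncM b w) (weight_intg_le v).1).
  apply: ae_in_imply (ae_in_and pinch trunc_sup) => x _ [[a0 ab _] ->].
  rewrite ler_wpM2l ?powR_ge0// hlinE mulN1r.
  have := ler_norm (v x); have := lt_le_trans a0 ab; lra.
have h3 := weight_young v ltr01; rewrite invr1 !mul1r in h3.
exact: energy_lower_arith h1 h2 h3.
Qed.

(** The parallelogram identity for the Dirichlet form and the convexity of the
    potential. *)
Lemma energy_midpoint u v : exists w,
  energy w + 8^-1 * Dir (hlin u v (-1)) (hlin u v (-1)) <= 2^-1 * energy u + 2^-1 * energy v.
Proof.
pose m := hlin (hlin u u (- 2^-1)) v 2^-1; exists m.
have mE x : m x = 2^-1 * u x + 2^-1 * v x by rewrite /m !hlinE; field.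
pose w1 := hlin u m (-1); pose w2 := hlin v m (-1).
have h1 : potential m - Int (fun x => trunc m x * w1 x) <= potential u.
  by apply: potential_tangent => x; rewrite hlinE mulN1r.
have h2 : potential m - Int (fun x => trunc m x * w2 x) <= potential v.
  by apply: potential_tangent => x; rewrite hlinE mulN1r.
have h3 : Int (fun x => trunc m x * w1 x) + Int (fun x => trunc m x * w2 x) = 0.
  rewrite -(RintegralD mO (intg_truncM m w1) (intg_truncM m w2)).
  transitivity (Int (fun=> 0)); last by rewrite Rintegral_cst// mul0r.
  by apply: eq_Rintegral => x _; rewrite !hlinE; field.
have dm : Dir m m = 4^-1 * (Dir u u + 2 * Dir u v + Dir v v).
  rewrite /m Dir_sqr Dir_sqr Dir_hlin.
  by move: (Dir u u) (Dir u v) (Dir v v) => A B C; field.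
rewrite /energy dm Dir_sqr.
exact: midpoint_arith h1 h2 h3.
Qed.

Lemma energy_has_inf : has_inf [set energy v | v in [set: H10 Omega]].
Proof.
split; first by exists (energy a), a.
by exists (potential b - 2^-1 * Dir b b) => _ [v _ <-]; exact: energy_ge.
Qed.

(** Bounded below and strongly convex, the energy has Cauchy minimizing sequences;
    the rate 8^(-k) is the one asked for by [H10_complete]. *)
Lemma energy_minimizing : exists (u : nat -> H10 Omega) (w : H10 Omega),
  (forall e, 0 < e -> \forall k \near \oo, forall v, energy (u k) <= energy v + e) /\
  (fun k => h1_dist (u k) (dx (u k)) w (dx w)) @ \oo --> (0 : R).
Proof.
pose m := inf [set energy v | v in [set: H10 Omega]].
have inf_le v : m <= energy v by apply: ge_inf; [exact: energy_has_inf.2|exists v].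
have [C C0 pC] := poincare oO bO.
have C8 : 0 < 8 * (C + 1) by rewrite mulr_gt0// ltr_wpDl.
pose e (k : nat) : R := 8^-1 ^+ k / (8 * (C + 1)).
have e0 k : 0 < e k by rewrite divr_gt0// exprn_gt0// invr_gt0.
have hu k : exists u, energy u <= m + e k.
  have [_ [u _ <-] h] := inf_adherent (e0 k) energy_has_inf.
  by exists u; exact: ltW.
have [u energy_u] := choice hu.
have eS k : e k.+1 <= e k.
  rewrite ler_pM2r ?invr_gt0// exprS ler_piMl//.
  by rewrite invf_le1// ler1n.
have [k|w cw] := @H10_complete R n Omega oO bO u.
  pose z := hlin (u k.+1) (u k) (-1).
  have [v hv] := energy_midpoint (u k.+1) (u k).
  have Dz : Dir z z <= 8 * e k.
    exact: (cauchy_arith hv (inf_le v) (energy_u k.+1) (energy_u k) (eS k)).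
  rewrite (h1_dist_Dir oO bO) -/z.
  apply: (@le_trans _ _ ((C + 1) * Dir z z)).
    by rewrite mulrDl mul1r lerD2r; exact: pC.
  apply: (@le_trans _ _ ((C + 1) * (8 * e k))).
    by rewrite ler_wpM2l// addr_ge0.
  rewrite /e le_eqVlt; apply/orP; left; apply/eqP; field.
  by rewrite gt_eqF// ltr_wpDl.
exists u, w; split=> // d d0.
have ce : e @ \oo --> (0 : R).
  rewrite -[X in _ --> X](mul0r (8 * (C + 1))^-1); apply: cvgMl; apply: cvg_expr.
  by rewrite ger0_norm ?invr_ge0// invf_lt1// ltr1n.
move/cvgrPdist_lt : ce => /(_ _ d0); apply: filterS => k; rewrite sub0r normrN => ek v.
have := energy_u k; have := inf_le v; have := ler_norm (e k); lra.
Qed.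

(** Lower semicontinuity: with z = u_k - w the energy of u_k is at least that of w
    plus the linear terms Dir w z and - int trunc w z, both small since
    Dir z z <= t^2.  The step t is chosen so that they cost at most d / 2. *)
Lemma energy_minimum : exists w, forall v, energy w <= energy v.
Proof.
have [u [w [umin cw]]] := energy_minimizing; exists w => v.
pose C := Dir w w + 1 + pinch_const * (Dir b b + 1).
have C0 : 0 < C.
  have := Dir_ge0 w; have := Dir_ge0 b; have := pinch_const_ge0.
  rewrite /C; move: (Dir w w) (Dir b b) => A B k0 B0 A0.
  by have := mulr_ge0 k0 B0; lra.
apply/ler_addgt0Pr => d d0; pose t := d / (2 * C).
have t0 : 0 < t by rewrite divr_gt0// mulr_gt0.
have d2 : 0 < d / 2 by rewrite divr_gt0.
have tE : t * C = d / 2 by rewrite /t; field; rewrite gt_eqF.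
have t2 : 0 < t ^+ 2 by rewrite exprn_gt0.
have hc : \forall k \near \oo, h1_dist (u k) (dx (u k)) w (dx w) <= t ^+ 2.
  move/cvgrPdist_le : cw => /(_ _ t2); apply: filterS => k.
  by rewrite sub0r normrN; apply: le_trans; exact: ler_norm.
have [k [hk1 hk2]] : exists k, (forall v, energy (u k) <= energy v + d / 2) /\
    h1_dist (u k) (dx (u k)) w (dx w) <= t ^+ 2.
  have [K1 _ H1] := umin _ d2; have [K2 _ H2] := hc.
  by exists (maxn K1 K2); split; [apply: H1|apply: H2]; rewrite /= leq_max leqnn ?orbT.
pose z := hlin (u k) w (-1).
have Dz : Dir z z <= t ^+ 2 by apply: le_trans hk2; exact: Dir_le_h1_dist.
have Dz' : t^-1 * Dir z z <= t.
  by rewrite ler_pdivrMl// -expr2.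
have zE x : z x = u k x - w x by rewrite hlinE mulN1r.
have h1 : potential w - Int (fun x => trunc w x * z x) <= potential (u k) by exact: potential_tangent.
have h2 : Int (fun x => trunc w x * z x) <= pinch_const * Int (fun x => weight x * `|z x|).
  rewrite -(RintegralZl pinch_const mO (weight_intg_le z).1).
  apply: (ae_le_Int mO (intg_truncM w z) (intg_weight z)).
  by apply: ae_in_imply (truncM_le w z) => x _; apply: le_trans; exact: ler_norm.
have h3 := weight_young z t0.
have Du : Dir (u k) (u k) = Dir w w + 2 * Dir w z + Dir z z.
  have -> : Dir z z = Dir (u k) (u k) - 2 * Dir (u k) w + Dir w w.
    by rewrite Dir_sqr sqrrN expr1n mul1r mulrN1 mulNr.
  have -> : Dir w z = Dir (u k) w - Dir w w by rewrite DirC Dir_hlin mulN1r.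
  by move: (Dir _ _) (Dir (u k) w) (Dir w w) => A B E; ring.
have h4 := Dir_young oO bO (hlin w w (-2)) z t0.
rewrite Dir_hlin Dir_sqr in h4.
have hv := hk1 v; rewrite /energy Du in hv.
exact: (minimum_arith pinch_const_ge0 (Dir_ge0 z) d0 tE Dz' h1 h2 h3 h4 hv).
Qed.


(** The energy of w + t v is at least that of w, while convexity bounds the change
    of the potential by - t int trunc (w + t v) v.  Divide by t and let t = 1 / (k + 1)
    tend to 0. *)
Lemma euler_le w : (forall v, energy w <= energy v) ->
  forall v, Int (fun x => trunc w x * v x) <= Dir w v.
Proof.
move=> wmin v; pose t (k : nat) : R := k.+1%:R^-1.
have t0 k : 0 < t k by rewrite invr_gt0.
pose u k := hlin w v (t k).
have Iu k : Int (fun x => trunc (u k) x * v x) <= Dir w v + 2^-1 * t k * Dir v v.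
  (* z is - t v, the displacement from u k back to w. *)
  pose z := hlin v v (- 1 - t k).
  have h1 : potential (u k) - Int (fun x => trunc (u k) x * z x) <= potential w.
    by apply: potential_tangent => x; rewrite !hlinE; ring.
  have h2 : Int (fun x => trunc (u k) x * z x) = - t k * Int (fun x => trunc (u k) x * v x).
    rewrite -(RintegralZl (- t k) mO (intg_truncM (u k) v)).
    by apply: eq_Rintegral => x _; rewrite hlinE; ring.
  have h3 := wmin (u k); rewrite /energy Dir_sqr in h3.
  exact: (variation_arith (t0 k) h1 h2 h3).
have ct : t @ \oo --> (0 : R) by exact: cvg_harmonic.
have cr : (fun k => Dir w v + 2^-1 * t k * Dir v v) @ \oo --> Dir w v.
  have c0 : (fun k => 2^-1 * t k * Dir v v) @ \oo --> 2^-1 * 0 * Dir v v.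
    by apply: cvgMl; apply: cvgMr.
  rewrite -[X in _ --> X]addr0 -(mul0r (Dir v v)) -[X in X * _](mulr0 2^-1).
  by apply: cvgD => //; exact: cvg_cst.
have cl : (fun k => Int (fun x => trunc (u k) x * v x)) @ \oo -->
    Int (fun x => trunc w x * v x).
  apply: (dominated_Int mO _ _ _ (intg_weight v) (fun k => truncM_le (u k) v)).2.
  - by move=> k; exact: (measurable_funM (mfun_trunc (u k)) (mfun_H10 v)).
  - exact: (measurable_funM (mfun_trunc w) (mfun_H10 v)).
  apply: ae_in_imply pinch => x _ [a0 ab _]; apply: cvgMl.
  apply: clip_powN_cvg => //.
  have -> : (fun k => u k x) = (fun k => w x + t k * v x).
    by apply/funext => k; rewrite hlinE.
  have c0 : (fun k => t k * v x) @ \oo --> 0 * v x by exact: cvgMl.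
  rewrite -[X in _ --> X]addr0 -(mul0r (v x)).
  by apply: cvgD => //; exact: cvg_cst.
by apply: (ler_cvg_to cl cr); apply: nearW.
Qed.

Lemma euler w : (forall v, energy w <= energy v) ->
  forall v, Dir w v = Int (fun x => trunc w x * v x).
Proof.
move=> wmin v; apply/eqP; rewrite eq_le (euler_le wmin v) andbT.
have := euler_le wmin (hlin v v (-2)).
rewrite DirC Dir_hlin (DirC v w).
have -> : Int (fun x => trunc w x * hlin v v (-2) x) = - Int (fun x => trunc w x * v x).
  rewrite -[RHS]mulN1r -(RintegralZl (-1) mO (intg_truncM w v)).
  by apply: eq_Rintegral => x _; rewrite hlinE; ring.
exact: opp_arith.
Qed.

(** * Comparison and uniqueness *)

(** Where (a - w)^+ does not vanish, trunc w = a^(-al).  So testing with this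
    function makes the two source terms cancel and leaves
    Dir (a - w) (a - w)^+ <= 0. *)
Lemma sub_le_critical w : (forall v, Dir w v = Int (fun x => trunc w x * v x)) ->
  {ae mu, forall x, Omega x -> a x <= w x}.
Proof.
move=> ew; pose z := hlin a w (-1); pose p := hpos z.
have p0 : ae_le Omega (cst 0) p.
  by apply: ae_in_all => x _; rewrite hposE /= le_max lexx orbT.
have eqI : {ae mu, forall x, Omega x -> trunc w x * p x = a x `^ (- al) * p x}.
  apply: ae_in_imply pinch => x _ [a0 ab _]; rewrite /p hposE hlinE mulN1r.
  have [h|h] := leP (a x - w x) 0; first by rewrite !mulr0.
  have wa : w x <= a x by rewrite -subr_ge0 ltW.
  rewrite /trunc /clip_powN; congr (_ `^ _ * _).
  case: (clipP (w x) ab) => -[h' ->] //; first by case/andP: h' => h' _; apply/eqP; rewrite eq_le wa.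
  by apply/eqP; rewrite eq_le ab (le_trans h').
have mp := measurable_funM (mfun_powN a) (mfun_H10 p).
have ia := ae_eq_intg mO mp eqI (intg_truncM w p).
have := suba p0; rewrite (dirichletE oO) /singular_term (EInt oO ia) -EFinB lee_fin subr_le0.
rewrite -(ae_eq_Int mO (measurable_funM (mfun_trunc w) (mfun_H10 p)) mp eqI) -ew => h.
have Dp : Dir p p <= 0.
  apply: le_trans (Dir_hpos oO bO z) _.
  by rewrite Dir_hlin mulN1r subr_le0.
apply: ae_in_imply (Dir0_ae0 oO bO Dp) => x _.
rewrite /p hposE hlinE mulN1r => /eqP.
by rewrite eq_le => /andP[+ _]; rewrite ge_max lexx andbT subr_le0.
Qed.

(** Symmetric: trunc w = b^(-al) where (w - b)^+ does not vanish. *)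
Lemma critical_le_super w : (forall v, Dir w v = Int (fun x => trunc w x * v x)) ->
  {ae mu, forall x, Omega x -> w x <= b x}.
Proof.
move=> ew; pose z := hlin w b (-1); pose p := hpos z.
have p0 : ae_le Omega (cst 0) p.
  by apply: ae_in_all => x _; rewrite hposE /= le_max lexx orbT.
have eqI : {ae mu, forall x, Omega x -> trunc w x * p x = b x `^ (- al) * p x}.
  apply: ae_in_imply pinch => x _ [a0 ab _]; rewrite /p hposE hlinE mulN1r.
  have [h|h] := leP (w x - b x) 0; first by rewrite !mulr0.
  have bw : b x <= w x by rewrite -subr_ge0 ltW.
  rewrite /trunc /clip_powN; congr (_ `^ _ * _).
  case: (clipP (w x) ab) => -[h' ->] //; last by case/andP: h' => _ h'; apply/eqP; rewrite eq_le bw h'.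
  by apply/eqP; rewrite eq_le ab (le_trans bw).
have mp := measurable_funM (mfun_powN b) (mfun_H10 p).
have ib := ae_eq_intg mO mp eqI (intg_truncM w p).
have := supb p0; rewrite (dirichletE oO) /singular_term (EInt oO ib) -EFinB lee_fin subr_ge0.
rewrite -(ae_eq_Int mO (measurable_funM (mfun_trunc w) (mfun_H10 p)) mp eqI) -ew => h.
have Dp : Dir p p <= 0.
  apply: le_trans (Dir_hpos oO bO z) _.
  by rewrite Dir_hlin mulN1r subr_le0.
apply: ae_in_imply (Dir0_ae0 oO bO Dp) => x _.
rewrite /p hposE hlinE mulN1r => /eqP.
by rewrite eq_le => /andP[+ _]; rewrite ge_max lexx andbT subr_le0.
Qed.

Lemma solution_exists : exists w, solution_between al a b w.
Proof.
have [w /euler ew] := energy_minimum; exists w.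
have aw := sub_le_critical ew; have wb := critical_le_super ew; split=> // v.
have eqI : {ae mu, forall x, Omega x -> trunc w x * v x = w x `^ (- al) * v x}.
  apply: ae_in_imply (ae_in_and aw wb) => x _ [h1 h2].
  by rewrite /trunc /clip_powN clip_id// h1.
have mv := measurable_funM (mfun_powN w) (mfun_H10 v).
have iv := ae_eq_intg mO mv eqI (intg_truncM w v).
split; first exact: iv.
rewrite (dirichletE oO) /singular_term (EInt oO iv) ew.
by rewrite (ae_eq_Int mO (measurable_funM (mfun_trunc w) (mfun_H10 v)) mv eqI).
Qed.

(** Testing the difference of the two equations with z = u - v gives
    Dir z z = int (u^(-al) - v^(-al)) (u - v) <= 0. *)
Lemma solution_unique u v : solution_between al a b u -> solution_between al a b v ->
  ae_le Omega u v.
Proof.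
move=> [su au _] [sv av _]; pose z := hlin u v (-1).
have [iu] := su z; rewrite (dirichletE oO) /singular_term (EInt oO iu) => -[Eu].
have [iv] := sv z; rewrite (dirichletE oO) /singular_term (EInt oO iv) => -[Ev].
have Dz : Dir z z <= 0.
  rewrite {1}/z Dir_hlin mulN1r Eu Ev subr_le0.
  apply: (ae_le_Int mO iu iv).
  apply: ae_in_imply (ae_in_and pinch (ae_in_and au av)) => x _ [[a0 _ _] [ux vx]].
  rewrite /z hlinE mulN1r; have u0 := lt_le_trans a0 ux; have v0 := lt_le_trans a0 vx.
  rewrite -subr_ge0 -mulrBl; have [uv|vu] := leP (u x) (v x).
    by apply: mulr_le0; rewrite subr_le0//; exact: powRN_le.
  by apply: mulr_ge0; rewrite subr_ge0; [exact: powRN_le (ltW vu)|exact: ltW].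
apply: ae_in_imply (Dir0_ae0 oO bO Dz) => x _.
by rewrite /z hlinE mulN1r => /eqP; rewrite subr_eq0 => /eqP ->.
Qed.

End singular_problem.

Theorem theorem3p3 (R : realType) (n : nat) (Omega : set 'rV[R]_n.+1)
    (alpha : R) (usub usup : H10 Omega) (c1 c2 : R) :
  smooth_bounded_domain Omega ->
  1 < alpha < 3 ->
  Linfty Omega usub -> Linfty Omega usup ->
  subsolution alpha usub -> supersolution alpha usup ->
  {ae lebesgue R n, forall x, Omega x ->
     [/\ 0 < c1 * bdist Omega x `^ (2 / (1 + alpha)),
         c1 * bdist Omega x `^ (2 / (1 + alpha)) <= usub x,
         usub x <= usup x
       & usup x <= c2 * bdist Omega x `^ (2 / (1 + alpha))]} ->
  exists umin umax : H10 Omega,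
    [/\ minimal_solution alpha usub usup umin,
        maximal_solution alpha usub usup umax
      & [/\ ae_le Omega usub umin, ae_le Omega umin umax
          & ae_le Omega umax usup]].
Proof.
move=> [oO _ _ bO _] /andP[al1 _] _ _ suba supb bounds.
have pinch : {ae lebesgue R n, forall x, Omega x ->
    [/\ 0 < usub x, usub x <= usup x & usup x <= c2 / c1 * usub x]}.
  apply: ae_in_imply bounds => x _; set d := _ `^ _ => -[cd0 cda ab bcd].
  have d0 : 0 <= d by exact: powR_ge0.
  have c10 : 0 < c1.
    rewrite ltNge; apply/negP => c10.
    by move: cd0; rewrite ltNge mulr_le0_ge0.
  have dp : 0 < d by move: cd0; rewrite pmulr_rgt0.
  have a0 := lt_le_trans cd0 cda; have b0 := lt_le_trans a0 ab.
  have c20 : 0 < c2 by rewrite -(pmulr_lgt0 _ dp); exact: lt_le_trans bcd.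
  split=> //; apply: le_trans bcd _.
  have -> : c2 * d = c2 / c1 * (c1 * d) by rewrite mulrA divfK ?gt_eqF.
  by rewrite ler_wpM2l// divr_ge0 ?ltW.
have [w sw] := solution_exists oO bO al1 pinch suba supb.
have uniq := solution_unique oO bO al1 pinch.
have [_ aw wb] := sw; exists w, w; split.
- by split=> // v sv; exact: uniq.
- by split=> // v sv; exact: uniq.
- by split=> //; apply: ae_in_all => x _.
Qed.
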